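(* Let $S,\Theta,(E,\mathcal{E},Q)$ and $\varphi$ be as in the context, and suppose (A.1)–(A.5) (listed in the context) hold. Let $f:S\to\mathbb{R}^p$ be continuous and increasing. Then there is a set $\hat\Omega\subset\Omega$ with $\gamma(\hat\Omega)=1$ such that for every $\omega\in\hat\Omega$ and each $\epsilon>0$ there is a constant $N_\epsilon(\omega)$, depending only on $\omega$ and $\epsilon$ (not on $s_0$), such that for every $s_0\in S$, $$\left|\frac1N\sum_{n=1}^N f(s_n(s_0,\omega,\theta))-E_\theta(f)\right|<\epsilon$$ for all $N\ge N_\epsilon(\omega)$ and all $\theta\in\Theta$.
   Context: Setting. $S=\{s\in\mathbb{R}^k : a_i\le s_i\le b_i,\ i=1,\dots,k\}$ with constants $a_i<b_i$, with Borel $\sigma$-algebra $\mathcal{S}$; $\geq$ is the coordinatewise partial order on Euclidean space. $(E,\mathcal{E})$ is a measurable space with a probability law $Q$ (the law of the i.i.d. shocks $\varepsilon$). $\Omega$ is the space of sequences $\omega=\{\varepsilon_n\}_{n\ge1}$ in $E$, with the product probability $\gamma$ constructed from $Q$. $\Theta\subset\mathbb{R}^l$ is compact, with its Borel $\sigma$-algebra. $\varphi:S\times E\times\Theta\to S$ is a function. A function $h$ on $S$ is increasing if $h(s)\ge h(s')$ whenever $s\ge s'$. For $s_0\in S$, $\omega=\{\varepsilon_n\}_{n\ge1}\in\Omega$ and $\theta\in\Theta$, the path $\{s_n(s_0,\omega,\theta)\}_{n\ge1}$ is defined recursively by $s_n(s_0,\omega,\theta)=\varphi(s_{n-1}(s_0,\omega,\theta),\varepsilon_n,\theta)$,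 $n\ge1$, starting at $s_0$. For a measurable map $\psi:S\times E\to S$, a Borel probability $\mu$ on $S$ is an invariant probability of $\psi$ if $\mu(A)=\int_S Q(\{\varepsilon:\psi(s,\varepsilon)\in A\})\,\mu(ds)$ for all $A\in\mathcal{S}$. Let $e=(1,\dots,1)\in\mathbb{R}^k$ and let $\mathrm{proj}_S$ be the nearest-point (Euclidean) projection of $\mathbb{R}^k$ onto $S$. For $\kappa>0$ define $$\varphi^\kappa(s,\varepsilon,\theta)=\mathrm{proj}_S[\varphi(\mathrm{proj}_S[s+\kappa e],\varepsilon,\theta)+\kappa e],\qquad \varphi_\kappa(s,\varepsilon,\theta)=\mathrm{proj}_S[\varphi(\mathrm{proj}_S[s-\kappa e],\varepsilon,\theta)-\kappa e].$$ For functions on $S\times E$, $\psi\ge\psi'$ means $\psi(s,\varepsilon)\ge\psi'(s,\varepsilon)$ for all $(s,\varepsilon)$. Assumptions: (A.1) $\varphi$ is measurable with respect to the product $\sigma$-algebra on $S\times E\times\Theta$. (A.2) For each $(\varepsilon,\theta)$, the mapping $\varphi(\cdot,\varepsilon,\theta):S\to S$ is increasing. (A.3) For every fixed $\theta$ and every continuous $g:S\to\mathbb{R}$, $\int g(\varphi(s_j,\varepsilon,\theta))Q(d\varepsilon)\to\int g(\varphi(s,\varepsilon,\theta))Q(d\varepsilon)$ whenever $s_j\to s$ in $S$. (A.4) For every $\theta\in\Theta$ and $\kappa>0$, the set $\{\theta'\in\Theta:\varphi^\kappa(\cdot,\cdot,\theta)\ge\varphi(\cdot,\cdot,\theta')\ge\varphi_\kappa(\cdot,\cdot,\theta)\}$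 contains an open neighborhood $V_\kappa(\theta)$ of $\theta$ (relative to $\Theta$). (A.5) For every $\theta\in\Theta$, the mapping $\varphi(\cdot,\cdot,\theta)$ has a unique invariant probability $\mu_\theta$. $E_\theta(f)=\int f(s)\,\mu_\theta(ds)$, and $|\cdot|$ is a norm on $\mathbb{R}^p$. *)

(* Defs.v *)
From HB Require Import structures.
From mathcomp Require Import all_boot all_order all_algebra.
From mathcomp Require Import all_classical all_reals all_analysis.

Set Implicit Arguments.
Unset Strict Implicit.
Unset Printing Implicit Defensive.

Import Order.TTheory GRing.Theory Num.Theory.
Import numFieldNormedType.Exports.

Local Open Scope classical_set_scope.
Local Open Scope ring_scope.

(* R^k is 'rV[R]_k with its Borel sigma-algebra.  The spaces S and Theta are
   sets in R^k and R^l, and functions on them are total functions of which only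
   the values on S and Theta matter; since S and Theta are Borel sets,
   measurable_fun on S `*` setT `*` Theta is measurability for the product of
   the Borel sigma-algebras of S and Theta with that of E. *)
HB.instance Definition _ (R : realType) (k : nat) :=
  Measurable.copy 'rV[R]_k (g_sigma_algebraType (@open 'rV[R]_k)).

Section vectors.
Context {R : realType}.
Implicit Type k : nat.

Definition lev k (x y : 'rV[R]_k) : Prop := forall i, x 0 i <= y 0 i.

Definition box k (a b : 'rV[R]_k) : set 'rV[R]_k :=
  [set s | forall i, a 0 i <= s 0 i <= b 0 i].

Definition increasing_on k p (S : set 'rV[R]_k) (h : 'rV[R]_k -> 'rV[R]_p) :=
  forall s s', S s -> S s' -> lev s' s -> lev (h s') (h s).

(* The norm carried by 'rV[R]_k in the library is the sup norm. *)
Definition eucl_dist k (x y : 'rV[R]_k) : R :=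
  Num.sqrt (\sum_(i < k) (x 0 i - y 0 i) ^+ 2).

Definition nearest_point k (C : set 'rV[R]_k) (x : 'rV[R]_k) : 'rV[R]_k :=
  get [set y | C y /\ forall z, C z -> eucl_dist x y <= eucl_dist x z].

Definition is_norm p (nrm : 'rV[R]_p -> R) : Prop :=
  [/\ forall x, 0 <= nrm x,
      forall x, nrm x = 0 -> x = 0,
      forall c x, nrm (c *: x) = `|c| * nrm x
    & forall x y, nrm (x + y) <= nrm x + nrm y].

End vectors.

Section shocks.
Context {d : measure_display} {E : measurableType d}.

Definition coordinate_cylinders : set (set (nat -> E)) :=
  [set C | exists n A, measurable A /\ C = [set w | A (w n)]].

End shocks.

(* A sequence of shocks {eps_n}_{n >= 1} is the function w with w n = eps_{n+1}. *)
Definition shock_seq {d} (E : measurableType d) :=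
  g_sigma_algebraType (@coordinate_cylinders d E).

(* The library has no countable products of probabilities: the product law is
   given by its values on the cylinders, which determine it uniquely. *)
Definition is_product_law {R : realType} {d} {E : measurableType d}
    (Q : probability E R) (gamma : probability (shock_seq E) R) : Prop :=
  forall (n : nat) (A : nat -> set E), (forall i, measurable (A i)) ->
    (gamma [set w : shock_seq E | forall i, (i < n)%N -> A i (w i)]
     = \prod_(i < n) Q (A i))%E.

Section dynamics.
Context {R : realType} {d : measure_display} {E : measurableType d} {k l : nat}.
Variables (S : set 'rV[R]_k) (Theta : set 'rV[R]_l) (Q : probability E R).
Variable phi : 'rV[R]_k -> E -> 'rV[R]_l -> 'rV[R]_k.

Fixpoint state_path (s0 : 'rV[R]_k) (w : shock_seq E) (th : 'rV[R]_l) (n : nat)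
    : 'rV[R]_k :=
  if n is m.+1 then phi (state_path s0 w th m) (w m) th else s0.

(* Probabilities on S are probabilities on R^k giving mass 1 to S. *)
Definition invariant_probability (psi : 'rV[R]_k -> E -> 'rV[R]_k)
    (mu : probability 'rV[R]_k R) : Prop :=
  mu S = 1%E /\
  forall A, measurable A -> A `<=` S ->
    mu A = (\int[mu]_(s in S) Q [set e | A (psi s e)])%E.

Definition unique_invariant_probability (psi : 'rV[R]_k -> E -> 'rV[R]_k)
    (mu : probability 'rV[R]_k R) : Prop :=
  invariant_probability psi mu /\
  forall nu : probability 'rV[R]_k R, invariant_probability psi nu ->
    forall A, measurable A -> A `<=` S -> nu A = mu A.

Definition phi_up (kappa : R) (s : 'rV[R]_k) (e : E) (th : 'rV[R]_l) :=
  nearest_point S (phi (nearest_point S (s + const_mx kappa)) e th + const_mx kappa).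

Definition phi_down (kappa : R) (s : 'rV[R]_k) (e : E) (th : 'rV[R]_l) :=
  nearest_point S (phi (nearest_point S (s - const_mx kappa)) e th - const_mx kappa).

Definition jointly_measurable : Prop :=
  measurable_fun (S `*` [set: E] `*` Theta)
    (fun x : 'rV[R]_k * E * 'rV[R]_l => phi x.1.1 x.1.2 x.2).

Definition monotone_in_state : Prop :=
  forall e th, Theta th -> increasing_on S (fun s => phi s e th).

Definition weakly_continuous : Prop :=
  forall th, Theta th ->
  forall g : 'rV[R]_k -> R, {within S, continuous g} ->
  forall (u : nat -> 'rV[R]_k) (s : 'rV[R]_k),
    (forall j, S (u j)) -> S s -> u @ \oo --> s ->
    (fun j => \int[Q]_e g (phi (u j) e th)) @ \oo -->
      \int[Q]_e g (phi s e th).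

Definition sandwiched_near : Prop :=
  forall th, Theta th -> forall kappa : R, 0 < kappa ->
  exists V : set 'rV[R]_l, [/\ open V, V th &
    V `&` Theta `<=` [set th' | Theta th' /\
      forall s e, S s ->
        lev (phi s e th') (phi_up kappa s e th) /\
        lev (phi_down kappa s e th) (phi s e th')]].

Definition unique_invariant_laws (mu : 'rV[R]_l -> probability 'rV[R]_k R) : Prop :=
  forall th, Theta th ->
    unique_invariant_probability (fun s e => phi s e th) (mu th).

End dynamics.

Definition expectation_on {R : realType} {k p : nat} (S : set 'rV[R]_k)
    (mu : probability 'rV[R]_k R) (f : 'rV[R]_k -> 'rV[R]_p) : 'rV[R]_p :=
  \row_j \int[mu]_(s in S) f s 0 j.

(* Main.v *)
(* For fixed th the chain started at the extreme point b can only increase when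
   it is reset to b.  Cutting time into blocks of length m and resetting at the
   start of each block bounds the partial sums of an increasing h along every
   path from above by sums of i.i.d. bounded block variables, whose averages are
   controlled almost surely by a Chernoff bound and Borel-Cantelli.  Running the
   block chain with phi_up kappa instead of phi makes the bound valid for all
   parameters in a neighbourhood of th, by (A.4).
   The mean of a block is the sum of the T_kappa^i h (b), i <= m.  As kappa -> 0
   it tends to the sum of the T^i h (b), because T preserves continuity (A.3).
   As i -> oo, T^i h (b) tends to E_th h: the backward iterates
   phi (... phi (b, e_n) ..., e_1) decrease pointwise to a random point, with
   T^i h (b) the mean of h at the i-th iterate, and the law of the limit is
   invariant, hence equal to mu_th by (A.5).
   The lower bound is the same argument for the reversed order, starting at a.
   The bounds around th apply to each nearby th', which forces E_th' f to be
   close to E_th f; compactness of Theta and countably many eps conclude. *)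
Require Import Defs.
From HB Require Import structures.
From mathcomp Require Import all_boot all_order all_algebra.
From mathcomp Require Import finmap all_classical all_reals all_analysis.
From mathcomp Require Import measurable_realfun ring lra.

Set Implicit Arguments.
Unset Strict Implicit.
Unset Printing Implicit Defensive.

Import Order.TTheory GRing.Theory Num.Theory.
Import numFieldNormedType.Exports.

Local Open Scope classical_set_scope.
Local Open Scope ring_scope.

(** * Boxes and Borel sets of row vectors *)

Section box.
Context {R : realType} {k : nat}.
Implicit Types x y z : 'rV[R]_k.

Lemma lev_trans x y z : lev x y -> lev y z -> lev x z.
Proof. by move=> xy yz i; exact: le_trans (xy i) (yz i). Qed.

(** Closed form of the projection onto the box. It is defined everywhere, so composing with it
    extends functions from the box to the whole space. *)
Definition clamp (a b x : 'rV[R]_k) : 'rV[R]_k :=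
  \row_i Num.max (a 0 i) (Num.min (x 0 i) (b 0 i)).

Variables a b : 'rV[R]_k.
Hypothesis hab : forall i, a 0 i <= b 0 i.

Lemma box_clamp x : box a b (clamp a b x).
Proof.
by move=> i; rewrite !mxE le_max lexx/= ge_max hab/= ge_min lexx orbT.
Qed.

Lemma clamp_id x : box a b x -> clamp a b x = x.
Proof.
move=> bx; apply/rowP => i; rewrite mxE; have /andP[ax xb] := bx i.
by rewrite (min_idPl xb) (max_idPr ax).
Qed.

Lemma lev_clamp x y : lev x y -> lev (clamp a b x) (clamp a b y).
Proof.
move=> xy i; rewrite !mxE ge_max le_max lexx/= le_max; apply/orP; right.
by rewrite le_min !ge_min (xy i) lexx !orbT.
Qed.

Lemma clamp_dist x y i : `|clamp a b x 0 i - clamp a b y 0 i| <= `|x 0 i - y 0 i|.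
Proof.
rewrite !mxE.
move: (x 0 i) (y 0 i) (a 0 i) (b 0 i) (hab i) => {x y} x y a0 b0 ab.
wlog xy : x y / x <= y.
  move=> H; case/orP: (le_total x y) => [/H//|/H].
  by rewrite distrC (distrC y).
rewrite distrC (distrC x) !ger0_norm ?subr_ge0//; last first.
  by rewrite ge_max le_max lexx/= le_max le_min !ge_min xy lexx !orbT.
by case: (leP y b0) => yb; case: (leP x b0) => xb;
  case: (leP a0 x) => ?; case: (leP a0 y) => ?; case: (leP a0 b0) => ?; lra.
Qed.

(** Coordinate by coordinate, the angle at [clamp a b x] between [x] and a point [z] of the box is
    obtuse, so the squared distance from [x] to [z] is at least the sum of the squared distances
    from [clamp a b x] to [x] and to [z]. This gives minimality, and any other minimiser is at
    distance 0 from [clamp a b x]. *)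
Lemma nearest_point_box x : nearest_point (box a b) x = clamp a b x.
Proof.
have obtuse z : box a b z ->
    \sum_(i < k) (x 0 i - z 0 i) ^+ 2 >=
    \sum_(i < k) (x 0 i - clamp a b x 0 i) ^+ 2 +
    \sum_(i < k) (clamp a b x 0 i - z 0 i) ^+ 2.
  move=> bz; rewrite -big_split; apply: ler_sum => i _ /=.
  rewrite !mxE; have /andP[] := bz i; move: (x 0 i) (z 0 i) (a 0 i) (b 0 i).
  move=> {}x {bz}z a0 b0 az zb.
  case: (leP x b0) => xb; [case: (leP a0 x)|case: (leP a0 b0)] => ax; last by lra.
  - by rewrite subrr expr0n add0r.
  - have : 0 <= (a0 - x) * (z - a0) by rewrite mulr_ge0//; lra.
    nra.
  - have : 0 <= (x - b0) * (b0 - z) by rewrite mulr_ge0//; lra.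
    nra.
have sq_ge0 (y z : 'rV[R]_k) : 0 <= \sum_(i < k) (y 0 i - z 0 i) ^+ 2.
  by apply: sumr_ge0 => i _; exact: sqr_ge0.
have bc := box_clamp x.
rewrite /nearest_point; set P := (X in get X).
have [bg ming] : P (get P).
  apply: getPex; exists (clamp a b x); split=> // z bz.
  rewrite /eucl_dist ler_sqrt ?sq_ge0//.
  by apply: le_trans (obtuse _ bz); rewrite lerDl.
move: (get P) bg ming => y by_ /(_ _ bc).
rewrite /eucl_dist ler_sqrt ?sq_ge0// => le_y.
have /eqP : \sum_(i < k) (clamp a b x 0 i - y 0 i) ^+ 2 = 0.
  apply/eqP; rewrite eq_le sq_ge0 andbT.
  by move: (le_trans (obtuse _ by_) le_y); rewrite gerDl.
rewrite psumr_eq0; last by move=> i _; exact: sqr_ge0.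
move=> /allP cy; apply/rowP => i; apply/esym/eqP.
by have := cy i (mem_index_enum _); rewrite /= sqrf_eq0 subr_eq0.
Qed.

Lemma norm_le_coord m (x : 'rV[R]_m) e : 0 <= e ->
  (forall i, `|x 0 i| <= e) -> `|x| <= e.
Proof.
move=> e0 xe; rewrite [leLHS]mx_normrE; apply/bigmax_leP; split=> // -[i j] _.
by rewrite /= ord1.
Qed.

Lemma coord_le_norm m (x : 'rV[R]_m) i : `|x 0 i| <= `|x|.
Proof.
by rewrite [leRHS]mx_normrE; apply/bigmax_geP; right; exists (0, i).
Qed.

Lemma clamp_continuous : continuous (clamp a b).
Proof.
move=> x; apply/(@cvgrPdist_le _ _ _ (nbhs x)) => e e0; near=> y.
apply: (@norm_le_coord _ _ _ (ltW e0)) => i; rewrite !mxE.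
have := clamp_dist x y i; rewrite !mxE => /le_trans; apply.
have := coord_le_norm (x - y) i; rewrite !mxE => /le_trans; apply.
by near: y; move: e e0; apply/cvgrPdist_le; exact: cvg_id.
Unshelve. all: by end_near. Qed.

Lemma compact_box : compact (box a b).
Proof.
rewrite (_ : box a b = [set v | forall i, v ord0 i \in `[a 0 i, b 0 i]]).
  apply: (@rV_compact _ _ (fun i => `[a 0 i, b 0 i]%classic)) => i.
  exact: segment_compact.
by apply/seteqP; split=> x /= bx i; have := bx i; rewrite in_itv.
Qed.

End box.

Section borel.
Context {R : realType}.

Lemma open_rV_measurable k (U : set 'rV[R]_k) : open U -> measurable U.
Proof. by move=> oU; apply: sub_sigma_algebra. Qed.

Lemma closed_rV_measurable k (C : set 'rV[R]_k) : closed C -> measurable C.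
Proof.
move=> cC; rewrite -[C]setCK; apply: measurableC.
by apply: open_rV_measurable; exact: closed_openC.
Qed.

Lemma measurable_box k (a b : 'rV[R]_k) : measurable (box a b).
Proof.
apply: closed_rV_measurable; apply: compact_closed; last exact: compact_box.
exact: norm_hausdorff.
Qed.

Lemma measurable_to_rV d (T : measurableType d) k (F : T -> 'rV[R]_k) :
  (forall U, open U -> measurable (F @^-1` U)) -> measurable_fun setT F.
Proof.
move=> mF; apply: (@measurability _ _ _ _ _ _ (@open 'rV[R]_k)) => //.
by move=> _ [U oU <-]; rewrite setTI; exact: mF.
Qed.

Lemma continuous_rV_measurable k m (F : 'rV[R]_k -> 'rV[R]_m) :
  continuous F -> measurable_fun setT F.
Proof.
move=> /continuousP cF; apply: measurable_to_rV => U oU.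
by apply: open_rV_measurable; exact: cF.
Qed.

Lemma continuous_rV_measurable_real k (F : 'rV[R]_k -> R) :
  continuous F -> measurable_fun setT F.
Proof.
move=> /continuousP cF.
apply: (measurability _ (measurable_realfun.RGenOpens.measurableE R)).
move=> _ [_ [x [y ->]] <-]; rewrite setTI.
by apply: open_rV_measurable; apply: cF; exact: interval_open.
Qed.

(** [D] is the distance to [C] cut off at 1. The empty set is treated apart, its distance function
    being infinite. *)
Lemma closed_zero_set k (C : set 'rV[R]_k) : closed C ->
  exists D : 'rV[R]_k -> R, [/\ continuous D, (forall x, 0 <= D x <= 1) &
    C = [set x | D x = 0]].
Proof.
move=> cC; have [->|/set0P[c Cc]] := eqVneq C set0.
  exists (fun=> 1); split; first exact: cst_continuous.
  - by move=> x; rewrite lexx ler01.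
  - by apply/seteqP; split=> // x /= /eqP; rewrite oner_eq0.
have Cfin x : edist_inf C x \is a fin_num.
  rewrite ge0_fin_numE ?edist_inf_ge0//.
  apply: le_lt_trans (_ : edist (x, c) < +oo)%E.
    by apply: ereal_inf_lbound; exists c.
  rewrite -ge0_fin_numE ?edist_ge0//; apply/edist_finP.
  exists (`|x - c| + 1); first by rewrite ltr_wpDl.
  by rewrite -ball_normE /ball_/= ltrDl.
exists ((fun x => fine (edist_inf C x)) \min (fun=> 1)); split.
- move=> x; apply: continuous_min; last exact: cst_continuous.
  by apply: fine_cvg; [exact: nbhs_filter|rewrite fineK//; exact: edist_inf_continuous].
- by move=> x; rewrite /= le_min ge_min lexx orbT fine_ge0 ?edist_inf_ge0//= ler01.
- apply/seteqP; split=> [x Cx|x /= D0].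
    by rewrite /= edist_inf0// fine0 min_l.
  have dx0 : edist_inf C x = 0%E.
    rewrite -[LHS]fineK//; congr EFin.
    by move: D0; case: leP => // _ /eqP; rewrite oner_eq0.
  apply: cC => U; rewrite -nbhs_ballE => -[e /= e0 eU].
  have : (edist_inf C x < e%:E)%E by rewrite dx0 lte_fin.
  move=> /ereal_inf_lt[_ [z Cz <-]] xz; exists z; split=> //; apply: eU.
  exact: (@edist_lt_ball R _ _ (x, z)).
Qed.

(** The complement of an open set is the zero set of a continuous [D], which reduces the claim to
    the real limit [D \o G] of the functions [D \o F n]. *)
Lemma measurable_rV_limit d (T : measurableType d) k (F : nat -> T -> 'rV[R]_k)
    (G : T -> 'rV[R]_k) :
  (forall n, measurable_fun setT (F n)) -> (forall x, F ^~ x @ \oo --> G x) ->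
  measurable_fun setT G.
Proof.
move=> mF FG; apply: measurable_to_rV => U oU.
have [D [cD D01 UD]] := closed_zero_set (open_closedC oU).
have mDG : measurable_fun setT (D \o G).
  apply: (@measurable_fun_cvg _ _ _ _ (fun n => D \o F n)).
    by move=> n; apply: measurableT_comp; [exact: continuous_rV_measurable_real|].
  by move=> x _; apply: continuous_cvg; [exact: cD|exact: FG].
rewrite -[G @^-1` U]setCK; apply: measurableC.
rewrite preimage_setC UD -[X in measurable X]setTI.
rewrite (_ : G @^-1` _ = (D \o G) @^-1` [set 0])//.
exact: mDG.
Qed.

End borel.

(** * Expectations of bounded measurable functions *)

(** A class of integrands that are integrable under every probability, so that [Rintegral] acts on
    it as a linear monotone expectation without side conditions. *)
Definition bounded_mfun {R : realType} d (T : measurableType d) (g : T -> R) :=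
  measurable_fun setT g /\ exists M : R, forall x, `|g x| <= M.

Section bounded_mfun.
Context {R : realType}.

Lemma bounded_mfun_comp d d' (T : measurableType d) (U : measurableType d')
    (g : U -> R) (F : T -> U) :
  bounded_mfun g -> measurable_fun setT F -> bounded_mfun (g \o F).
Proof.
move=> [mg [M gM]] mF; split; first exact: measurableT_comp.
by exists M => x; exact: gM.
Qed.

Section closure.
Context {d} {T : measurableType d}.
Implicit Types f g : T -> R.

Lemma bounded_mfun_cst (c : R) : bounded_mfun (fun _ : T => c).
Proof. by split; [exact: measurable_cst|exists `|c|]. Qed.

Lemma bounded_mfunD f g : bounded_mfun f -> bounded_mfun g ->
  bounded_mfun (fun x => f x + g x).
Proof.
move=> [mf [M fM]] [mg [N gN]]; split; first exact: measurable_funD.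
by exists (M + N) => x; apply: le_trans (ler_normD _ _) _; exact: lerD.
Qed.

Lemma bounded_mfunM f g : bounded_mfun f -> bounded_mfun g ->
  bounded_mfun (fun x => f x * g x).
Proof.
move=> [mf [M fM]] [mg [N gN]]; split; first exact: measurable_funM.
by exists (M * N) => x; rewrite normrM; exact: ler_pM.
Qed.

Lemma bounded_mfunZ c f : bounded_mfun f -> bounded_mfun (fun x => c * f x).
Proof. exact/bounded_mfunM/bounded_mfun_cst. Qed.

Lemma bounded_mfunB f g : bounded_mfun f -> bounded_mfun g ->
  bounded_mfun (fun x => f x - g x).
Proof.
move=> bf /(bounded_mfunZ (-1)) /(bounded_mfunD bf).
by under eq_fun do rewrite mulN1r.
Qed.

Lemma bounded_mfun_sum I (r : seq I) (F : I -> T -> R) :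
  (forall i, bounded_mfun (F i)) -> bounded_mfun (fun x => \sum_(i <- r) F i x).
Proof.
move=> bF; elim: r => [|i r IH].
  by under eq_fun do rewrite big_nil; exact: bounded_mfun_cst.
by under eq_fun do rewrite big_cons; exact: bounded_mfunD.
Qed.

Lemma bounded_mfun_expR f : bounded_mfun f -> bounded_mfun (fun x => expR (f x)).
Proof.
move=> [mf [M fM]]; split; first exact: (measurableT_comp (@measurable_expR R)).
exists (expR M) => x; rewrite ger0_norm ?expR_ge0// ler_expR.
exact: le_trans (ler_norm _) (fM x).
Qed.

End closure.

Section expectation.
Context {d} {T : measurableType d} (P : probability T R).
Implicit Types f g : T -> R.

Lemma bounded_mfun_integrable f : bounded_mfun f -> P.-integrable setT (EFin \o f).
Proof.
move=> [mf [M fM]]; apply: measurable_bounded_integrable => //.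
  by rewrite -ge0_fin_numE// fin_num_measure.
exists M; split; first by rewrite num_real.
by move=> N MN x _; apply: le_trans (fM x) (ltW MN).
Qed.

Lemma EFin_expectation f : bounded_mfun f ->
  (\int[P]_x f x)%:E = (\int[P]_x (f x)%:E)%E.
Proof.
move=> bf; rewrite /Rintegral fineK//.
exact/integrable_fin_num/bounded_mfun_integrable.
Qed.

Lemma expectation_cst (c : R) : \int[P]_x c = c.
Proof.
rewrite Rintegral_cst// [X in fine X](_ : _ = 1%E) ?mulr1//.
exact: probability_setT.
Qed.

Lemma expectationD f g : bounded_mfun f -> bounded_mfun g ->
  \int[P]_x (f x + g x) = \int[P]_x f x + \int[P]_x g x.
Proof. by move=> bf bg; rewrite RintegralD//; exact: bounded_mfun_integrable. Qed.

Lemma expectationB f g : bounded_mfun f -> bounded_mfun g ->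
  \int[P]_x (f x - g x) = \int[P]_x f x - \int[P]_x g x.
Proof. by move=> bf bg; rewrite RintegralB//; exact: bounded_mfun_integrable. Qed.

Lemma expectationZ c f : bounded_mfun f ->
  \int[P]_x (c * f x) = c * \int[P]_x f x.
Proof. by move=> bf; rewrite RintegralZl//; exact: bounded_mfun_integrable. Qed.

Lemma expectation_sum I (r : seq I) (F : I -> T -> R) :
  (forall i, bounded_mfun (F i)) ->
  \int[P]_x (\sum_(i <- r) F i x) = \sum_(i <- r) \int[P]_x F i x.
Proof.
move=> bF; elim: r => [|i r IH].
  by under eq_Rintegral do rewrite big_nil; rewrite expectation_cst big_nil.
under eq_Rintegral do rewrite big_cons.
by rewrite expectationD ?big_cons ?IH//; exact: bounded_mfun_sum.
Qed.

Lemma le_expectation f g : bounded_mfun f -> bounded_mfun g ->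
  (forall x, f x <= g x) -> \int[P]_x f x <= \int[P]_x g x.
Proof. by move=> bf bg fg; apply: le_Rintegral => //; exact: bounded_mfun_integrable. Qed.

Lemma expectation_dist f g e : bounded_mfun f -> bounded_mfun g ->
  (forall x, `|f x - g x| <= e) -> `|\int[P]_x f x - \int[P]_x g x| <= e.
Proof.
move=> bf bg fge; have bfg := bounded_mfunB bf bg.
rewrite -expectationB// ler_norml; apply/andP; split.
  rewrite -[leLHS]expectation_cst; apply: le_expectation => //.
    exact: bounded_mfun_cst.
  by move=> x; have := fge x; rewrite ler_norml => /andP[].
rewrite -[leRHS]expectation_cst; apply: le_expectation => //.
  exact: bounded_mfun_cst.
by move=> x; have := fge x; rewrite ler_norml => /andP[].
Qed.

Lemma expectation_norm_le f M : bounded_mfun f -> (forall x, `|f x| <= M) ->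
  `|\int[P]_x f x| <= M.
Proof.
move=> bf fM; have := @expectation_dist f (fun=> 0) M bf (bounded_mfun_cst 0).
by rewrite expectation_cst subr0; apply => x; rewrite subr0.
Qed.

Lemma bounded_convergence (F : nat -> T -> R) g M :
  (forall n, measurable_fun setT (F n)) -> (forall n x, `|F n x| <= M) ->
  (forall x, F ^~ x @ \oo --> g x) ->
  bounded_mfun g /\ (fun n => \int[P]_x F n x) @ \oo --> \int[P]_x g x.
Proof.
move=> mF FM Fg.
have mg : measurable_fun setT g.
  by apply: (@measurable_fun_cvg _ _ _ _ F) => // x _; exact: Fg.
have gM x : `|g x| <= M.
  by apply: cvgr_to_le (cvg_norm (Fg x)) _; apply: nearW => n; exact: FM.
have bF n : bounded_mfun (F n) by split=> //; exists M.
have bg : bounded_mfun g by split=> //; exists M.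
split=> //; have [] := @dominated_convergence _ _ _ P setT measurableT
  (fun n => EFin \o F n) (EFin \o g) (cst M%:E).
- by move=> n; apply/measurable_EFinP.
- exact/measurable_EFinP.
- by apply: aeW => x _; apply: cvg_EFin; [exact: nearW|exact: Fg].
- exact/bounded_mfun_integrable/bounded_mfun_cst.
- by apply: aeW => x n _; rewrite /= lee_fin.
by move=> _ _; rewrite /= -EFin_expectation//; exact: fine_cvg.
Qed.

End expectation.

(** * Image laws, Fubini's theorem, and laws determined by continuous functions *)

Lemma law_exists d d' (T : measurableType d) (U : measurableType d')
    (P : probability T R) (F : T -> U) : measurable_fun setT F ->
  exists nu : probability U R, forall A, measurable A -> nu A = P (F @^-1` A).
Proof.
by move=> mF; exists (distribution P (mfun_Sub (mem_set mF))).
Qed.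

Lemma law_expectation d d' (T : measurableType d) (U : measurableType d')
    (P : probability T R) (F : T -> U) (nu : probability U R) (g : U -> R) :
  measurable_fun setT F -> (forall A, measurable A -> nu A = P (F @^-1` A)) ->
  bounded_mfun g -> \int[nu]_y g y = \int[P]_x g (F x).
Proof.
move=> mF nuE bg; congr fine.
rewrite (eq_measure_integral (pushforward P F)); last first.
  by move=> A mA _; exact: nuE.
rewrite integral_pushforward//.
  by apply/measurable_EFinP; case: bg.
rewrite preimage_setT; apply: bounded_mfun_integrable.
exact: bounded_mfun_comp.
Qed.

Section fubini.
Context {d d'} {T : measurableType d} {U : measurableType d'}.
Variables (P : probability T R) (P' : probability U R).
Variable g : T * U -> R.
Hypothesis bg : bounded_mfun g.

Let bg1 x : bounded_mfun (fun y => g (x, y)).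
Proof. exact: (bounded_mfun_comp bg (pair1_measurable x)). Qed.

Let bg2 y : bounded_mfun (fun x => g (x, y)).
Proof. exact: (bounded_mfun_comp bg (pair2_measurable y)). Qed.

Lemma bounded_mfun_section1 : bounded_mfun (fun x => \int[P']_y g (x, y)).
Proof.
split; last first.
  have [_ [M gM]] := bg; exists M => x; exact: expectation_norm_le.
apply/measurable_EFinP; rewrite (_ : _ \o _ = fubini_F P' (EFin \o g)).
  apply: measurable_fubini_F; exact: (bounded_mfun_integrable (P \x P')%E bg).
by apply/funext => x; rewrite /= EFin_expectation.
Qed.

Lemma expectation_prod1 :
  \int[(P \x P')%E]_z g z = \int[P]_x \int[P']_y g (x, y).
Proof.
congr fine; rewrite -integral12_prod_meas1; last first.
  exact: (bounded_mfun_integrable (P \x P')%E bg).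
by apply: eq_integral => x _; rewrite EFin_expectation.
Qed.

Lemma expectation_prod2 :
  \int[(P \x P')%E]_z g z = \int[P']_y \int[P]_x g (x, y).
Proof.
congr fine; rewrite -integral21_prod_meas1; last first.
  exact: (bounded_mfun_integrable (P \x P')%E bg).
by apply: eq_integral => x _; rewrite EFin_expectation.
Qed.

End fubini.

(** The closed sets form a generating system stable under intersection. For [C] closed with zero-set
    function [D], the continuous functions [(1 - D) ^+ n] converge to the indicator of [C], so
    bounded convergence recovers the mass of [C] from integrals of continuous functions. *)
Lemma continuous_law_unique k (P P' : probability 'rV[R]_k R) :
  (forall g : 'rV[R]_k -> R, continuous g -> (forall x, `|g x| <= 1) ->
    \int[P]_x g x = \int[P']_x g x) ->
  forall A, measurable A -> P A = P' A.
Proof.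
move=> PP'; apply: (measure_unique (@closed 'rV[R]_k) (fun=> setT)) => //.
- rewrite eqEsubset; split; apply: smallest_sub.
  + exact: smallest_sigma_algebra.
  + move=> U /open_closedC cU; rewrite -[U]setCK.
    apply: (sigma_algebraC (G := @closed 'rV[R]_k)).
    exact: sub_sigma_algebra.
  + exact: smallest_sigma_algebra.
  + exact: closed_rV_measurable.
- exact: closedI.
- by rewrite bigcup_const//; exists 0%N.
- move=> C cC; have [D [cD D01 CD]] := closed_zero_set cC.
  pose g n x := (1 - D x) ^+ n.
  have g01 n x : 0 <= g n x <= 1.
    have /andP[D0 D1] := D01 x; rewrite exprn_ge0 ?subr_ge0//=.
    by rewrite exprn_ile1 ?subr_ge0// gerBl.
  have cg n : continuous (g n).
    move=> x; apply: (@continuous_comp _ _ _ (fun x => 1 - D x) (fun r => r ^+ n)).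
      by apply: continuousB; [exact: cst_continuous|exact: cD].
    exact: exprn_continuous.
  have gn1 n x : `|g n x| <= 1 by have /andP[g0 g1] := g01 n x; rewrite ger0_norm.
  have glim x : g ^~ x @ \oo --> (\1_C x : R).
    rewrite indicE; have [Cx|nCx] := pselect (C x).
      rewrite mem_set//; apply: cvg_near_cst; apply: nearW => n.
      by rewrite /g; move: Cx; rewrite CD => /= ->; rewrite subr0 expr1n.
    rewrite memNset//; apply: cvg_expr; have /andP[D0 D1] := D01 x.
    rewrite ger0_norm ?subr_ge0// gtrBl lt_neqAle D0 andbT eq_sym.
    by apply/eqP => Dx; apply: nCx; rewrite CD.
  have lim_of (mu : probability 'rV[R]_k R) :
      (fun n => \int[mu]_x g n x) @ \oo --> fine (mu C).
    rewrite (_ : fine _ = \int[mu]_x (\1_C x)).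
      apply: (bounded_convergence (M := 1) _ _ gn1 glim).2 => n.
      exact: continuous_rV_measurable_real.
    by rewrite /Rintegral integral_indic// ?setIT//; exact: closed_rV_measurable.
  have CE (mu : probability 'rV[R]_k R) : mu C = (fine (mu C))%:E.
    by rewrite fineK// fin_num_measure//; exact: closed_rV_measurable.
  suff h : fine (P C) = fine (P' C).
    by transitivity (fine (P C))%:E; [exact: CE|rewrite h; exact/esym/CE].
  apply: (cvg_unique _ (lim_of P)); first exact: norm_hausdorff.
  rewrite (_ : (fun n => _) = (fun n => \int[P']_x g n x)); first exact: lim_of.
  by apply/funext => n; exact: PP'.
- by move=> k0; rewrite -ge0_fin_numE// fin_num_measure.
Qed.

End bounded_mfun.

(** * The product law of the shocks *)

Section shock_sequences.
Context {R : realType} {d : measure_display} {E : measurableType d}.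

Definition shock_tail (w : shock_seq E) : shock_seq E := fun n => w n.+1.

Definition scons (e : E) (w : shock_seq E) : shock_seq E :=
  fun n => if n is m.+1 then w m else e.

(** Constraining an initial segment of coordinates, instead of a single one, gives a generating
    family stable under intersection; the product law prescribes its values exactly on these
    sets. *)
Definition cylinders : set (set (shock_seq E)) :=
  [set C | exists n (A : nat -> set E), (forall i, measurable (A i)) /\
    C = [set w | forall i, (i < n)%N -> A i (w i)]].

Lemma measurable_coord n : measurable_fun setT (fun w : shock_seq E => w n).
Proof.
move=> _ A mA; rewrite setTI; apply: sub_sigma_algebra.
by exists n, A.
Qed.

Lemma measurable_to_shock_seq d' (T : measurableType d') (F : T -> shock_seq E) :
  (forall n, measurable_fun setT (fun x => F x n)) -> measurable_fun setT F.
Proof.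
move=> mF; apply: (@measurability _ _ T (shock_seq E) setT F
  (@coordinate_cylinders d E)) => //.
move=> _ [_ [n [A [mA ->]]] <-]; exact: mF.
Qed.

Lemma measurable_shock_tail : measurable_fun setT shock_tail.
Proof. by apply: measurable_to_shock_seq => n; exact: measurable_coord. Qed.

Lemma measurable_iter_shock_tail m : measurable_fun setT (iter m shock_tail).
Proof.
elim: m => [|m IH]; first exact: measurable_id.
by apply: (measurableT_comp measurable_shock_tail).
Qed.

Lemma measurable_scons : measurable_fun setT (fun z : E * shock_seq E => scons z.1 z.2).
Proof.
apply: measurable_to_shock_seq => -[|n]; first exact: measurable_fst.
exact: (measurableT_comp (measurable_coord n) measurable_snd).
Qed.

Lemma cylinders_measurable C : cylinders C -> measurable C.
Proof.
move=> [n [A [mA ->]]].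
rewrite (_ : [set w | _] = \bigcap_(i in `I_n) [set w : shock_seq E | A i (w i)]).
  apply: bigcap_measurableType => i _.
  by rewrite -[X in measurable X]setTI; exact: measurable_coord.
by apply/seteqP; split=> w /= Aw i; exact: Aw.
Qed.

Lemma shock_law_unique (P P' : probability (shock_seq E) R) :
  (forall C, cylinders C -> P C = P' C) -> forall A, measurable A -> P A = P' A.
Proof.
move=> PP'; apply: (measure_unique cylinders (fun=> setT)) => //.
- rewrite eqEsubset; split; apply: smallest_sub.
  + exact: smallest_sigma_algebra.
  + move=> _ [n [A [mA ->]]]; apply: sub_sigma_algebra.
    exists n.+1, (fun i => if i == n then A else setT); split.
      by move=> i; case: ifP.
    apply/seteqP; split=> w /= => [Aw i _|/(_ n)]; first by case: eqP => // ->.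
    by rewrite eqxx; apply.
  + exact: smallest_sigma_algebra.
  + exact: cylinders_measurable.
- move=> _ _ [n [A [mA ->]]] [m [B [mB ->]]].
  exists (maxn n m), (fun i => (if (i < n)%N then A i else setT) `&`
                               (if (i < m)%N then B i else setT)); split.
    by move=> i; apply: measurableI; case: ifP.
  apply/seteqP; split=> w /= => [[Aw Bw] i _|H].
    by split; case: ifP => // im; [exact: Aw|exact: Bw].
  by split=> i im; have := H i; rewrite leq_max im ?orbT => /(_ isT) [].
- by move=> _; exists 0%N, (fun=> setT); split=> //; apply/seteqP; split.
- by rewrite bigcup_const//; exists 0%N.
- by move=> _; rewrite -ge0_fin_numE// fin_num_measure.
Qed.

Variables (Q : probability E R) (gamma : probability (shock_seq E) R).
Hypothesis hgamma : is_product_law Q gamma.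

(** A fresh shock put in front of an independent sequence again has the product law: on a cylinder
    the first factor splits off, and cylinders determine the law. All later uses of independence
    rest on this identity. *)
Lemma scons_law A : measurable A ->
  gamma A = (Q \x gamma)%E ((fun z => scons z.1 z.2) @^-1` A).
Proof.
have [nu nuE] := law_exists (Q \x gamma)%E measurable_scons.
move=> mA; rewrite -nuE//; apply: shock_law_unique mA => C mC.
have [n [B [mB CE]]] := mC.
rewrite nuE; last exact: cylinders_measurable.
rewrite CE hgamma//; case: n {mC CE} => [|n].
  rewrite big_ord0 (_ : preimage _ _ = setT); last by apply/seteqP; split.
  exact/esym/probability_setT.
rewrite (_ : preimage _ _ = B 0%N `*`
    [set w : shock_seq E | forall i, (i < n)%N -> B i.+1 (w i)]).
  rewrite big_ord_recl/= -(hgamma n (fun i => mB i.+1)).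
  apply/esym/product_measure1E => //.
  by apply: cylinders_measurable; exists n, (B \o S); split=> // i; exact: mB.
apply/seteqP; split=> -[e w] /= => [Bw|[B0 Bw] [|i] //= im].
  by split=> [|i im]; [exact: (Bw 0%N)|exact: (Bw i.+1)].
exact: Bw.
Qed.

Implicit Types F G : shock_seq E -> R.

Lemma expectation_scons_prod G : bounded_mfun G ->
  \int[gamma]_w G w = \int[(Q \x gamma)%E]_z G (scons z.1 z.2).
Proof.
by move=> bG; apply: law_expectation bG; [exact: measurable_scons|exact: scons_law].
Qed.

Lemma bounded_mfun_scons G : bounded_mfun G ->
  bounded_mfun (fun z : E * shock_seq E => G (scons z.1 z.2)).
Proof. by move=> bG; exact: bounded_mfun_comp bG measurable_scons. Qed.

Lemma expectation_scons G : bounded_mfun G ->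
  \int[gamma]_w G w = \int[Q]_e \int[gamma]_w G (scons e w).
Proof.
move=> bG; rewrite expectation_scons_prod// expectation_prod1//.
exact: bounded_mfun_scons.
Qed.

Lemma expectation_scons_swap G : bounded_mfun G ->
  \int[gamma]_w G w = \int[gamma]_w \int[Q]_e G (scons e w).
Proof.
move=> bG; rewrite expectation_scons_prod// expectation_prod2//.
exact: bounded_mfun_scons.
Qed.

Definition depends_on_first m F :=
  forall w w', (forall i, (i < m)%N -> w i = w' i) -> F w = F w'.

(** Induction on [m], integrating out the first shock [e]: the function [F (scons e w)] of [w] then
    depends on the first [m] shocks only. *)
Lemma expectation_indep m F G :
  bounded_mfun F -> bounded_mfun G -> depends_on_first m F ->
  \int[gamma]_w (F w * G (iter m shock_tail w)) =
  (\int[gamma]_w F w) * \int[gamma]_w G w.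
Proof.
move=> bF bG; elim: m F bF => [|m IH] F bF dF.
  (* For [m = 0] the function [F] is constant, so its value may be read at an arbitrary sequence. *)
  have F0 w : F w = F point by exact: dF.
  under eq_Rintegral do rewrite F0.
  rewrite expectationZ//; congr (_ * _).
  by under eq_Rintegral do rewrite F0; rewrite expectation_cst.
rewrite expectation_scons; last first.
  by apply: bounded_mfunM => //; exact: bounded_mfun_comp bG (measurable_iter_shock_tail _).
rewrite (expectation_scons bF).
have bFs e : bounded_mfun (fun w => F (scons e w)).
  exact: (bounded_mfun_comp (bounded_mfun_scons bF) (pair1_measurable e)).
rewrite mulrC -expectationZ; last first.
  exact: (bounded_mfun_section1 Q gamma (bounded_mfun_scons bF)).
apply: eq_Rintegral => e _; rewrite [RHS]mulrC.
have dFs : depends_on_first m (fun w => F (scons e w)).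
  by move=> w w' ww'; apply: dF => -[//|i] im; exact: ww'.
rewrite -(IH _ (bFs e) dFs).
by apply: eq_Rintegral => w _; rewrite iterSr.
Qed.

End shock_sequences.

(** * Iterated random maps and their invariant law *)

Section direction.
Context {R : realType} {k : nat}.

(* [u = true] is the coordinatewise order and [u = false] its reverse, so that
   upper and lower bounds are obtained by the same argument. *)
Definition lev_dir (u : bool) (x y : 'rV[R]_k) := if u then lev x y else lev y x.

Lemma lev_dir_trans u y x z : lev_dir u x y -> lev_dir u y z -> lev_dir u x z.
Proof. by case: u => /= xy yz; [exact: lev_trans yz|exact: lev_trans xy]. Qed.

Lemma cvg_rV (v : nat -> 'rV[R]_k) (y : 'rV[R]_k) :
  (forall i, (fun n => v n 0 i) @ \oo --> y 0 i) -> v @ \oo --> y.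
Proof.
move=> vy; apply/cvgrPdist_le => e e0.
have : \forall n \near \oo, forall i, `|y 0 i - v n 0 i| <= e.
  by apply: filter_forall => i; move: e e0; apply/cvgrPdist_le; exact: vy.
apply: filterS => n ne; apply: norm_le_coord (ltW e0) _ => i.
by rewrite !mxE; exact: ne.
Qed.

Lemma monotone_rV_cvg (a b : 'rV[R]_k) u (v : nat -> 'rV[R]_k) :
  (forall n, box a b (v n)) -> (forall n, lev_dir u (v n.+1) (v n)) ->
  exists2 y, box a b y & v @ \oo --> y.
Proof.
move=> bv vS.
have vcvg i : cvgn (fun n => v n 0 i).
  case: u vS => vS.
    apply: nonincreasing_is_cvgn.
      by apply/nonincreasing_seqP => n; exact: vS.
    by exists (a 0 i) => _ [n _ <-]; have /andP[] := bv n i.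
  apply: nondecreasing_is_cvgn.
    by apply/nondecreasing_seqP => n; exact: vS.
  by exists (b 0 i) => _ [n _ <-]; have /andP[] := bv n i.
exists (\row_i limn (fun n => v n 0 i)); last first.
  by apply: cvg_rV => i; rewrite mxE; exact: vcvg.
move=> i; rewrite mxE; apply/andP; split.
  by apply: limr_ge => //; apply: nearW => n; have /andP[] := bv n i.
by apply: limr_le => //; apply: nearW => n; have /andP[] := bv n i.
Qed.

End direction.

Section random_iteration.
Context {R : realType} {d : measure_display} {E : measurableType d} {k : nat}.
Variables (Q : probability E R) (gamma : probability (shock_seq E) R).
Hypothesis hgamma : is_product_law Q gamma.
Variable psi : 'rV[R]_k -> E -> 'rV[R]_k.
Hypothesis mpsi : measurable_fun setT (fun z : 'rV[R]_k * E => psi z.1 z.2).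
Implicit Types (s : 'rV[R]_k) (w : shock_seq E) (g : 'rV[R]_k -> R).

Fixpoint path_from s w n : 'rV[R]_k :=
  if n is m.+1 then psi (path_from s w m) (w m) else s.

(** The shocks act in reverse order: [w 0] drives the outermost map, and each new shock is inserted
    innermost. For fixed [n] the law is that of [path_from], but as [n] grows these iterates
    converge pathwise when started at an extreme point. *)
Fixpoint backward_path s w n : 'rV[R]_k :=
  if n is m.+1 then psi (backward_path s (shock_tail w) m) (w 0%N) else s.

Definition transition g s : R := \int[Q]_e g (psi s e).

Lemma path_fromSr s w n :
  path_from s w n.+1 = path_from (psi s (w 0%N)) (shock_tail w) n.
Proof. by elim: n => [//|n IH]; rewrite /= -IH. Qed.

Lemma path_from_prefix s w w' n : (forall i, (i < n)%N -> w i = w' i) ->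
  path_from s w n = path_from s w' n.
Proof.
elim: n => [//|n IH] ww' /=; rewrite ww'// IH// => i im.
by apply: ww'; exact: ltnW.
Qed.

Lemma measurable_psi2 d' (T : measurableType d') (F : T -> 'rV[R]_k) (G : T -> E) :
  measurable_fun setT F -> measurable_fun setT G ->
  measurable_fun setT (fun x => psi (F x) (G x)).
Proof.
move=> mF mG; apply: (measurableT_comp mpsi (g := fun x => (F x, G x))).
exact: measurable_fun_pair.
Qed.

Lemma measurable_path_from s n : measurable_fun setT (fun w => path_from s w n).
Proof.
elim: n => [|n IH] /=; first exact: measurable_cst.
by apply: measurable_psi2; [exact: IH|exact: measurable_coord].
Qed.

Lemma measurable_backward_path s n :
  measurable_fun setT (fun w => backward_path s w n).
Proof.
elim: n => [|n IH] /=; first exact: measurable_cst.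
apply: measurable_psi2; last exact: measurable_coord.
exact: (measurableT_comp IH measurable_shock_tail).
Qed.

Lemma bounded_mfun_psi g :
  bounded_mfun g -> bounded_mfun (fun z : 'rV[R]_k * E => g (psi z.1 z.2)).
Proof. by move=> bg; exact: bounded_mfun_comp bg mpsi. Qed.

Lemma bounded_mfun_psi_section g s :
  bounded_mfun g -> bounded_mfun (fun e => g (psi s e)).
Proof.
move=> bg; exact: (bounded_mfun_comp (bounded_mfun_psi bg) (pair1_measurable s)).
Qed.

Lemma bounded_mfun_transition g : bounded_mfun g -> bounded_mfun (transition g).
Proof.
(* The Dirac mass is an arbitrary first factor: measurability of the partial integral is read off a
   product probability. *)
by move=> bg; exact: (bounded_mfun_section1 (\d_ (0 : 'rV[R]_k)) Q (bounded_mfun_psi bg)).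
Qed.

Lemma bounded_mfun_iter_transition n g :
  bounded_mfun g -> bounded_mfun (iter n transition g).
Proof. by move=> bg; elim: n => [//|n IH]; exact: bounded_mfun_transition. Qed.

Lemma bounded_mfun_path g s n :
  bounded_mfun g -> bounded_mfun (fun w => g (path_from s w n)).
Proof. by move=> bg; exact: bounded_mfun_comp bg (measurable_path_from s n). Qed.

Lemma bounded_mfun_backward g s n :
  bounded_mfun g -> bounded_mfun (fun w => g (backward_path s w n)).
Proof. by move=> bg; exact: bounded_mfun_comp bg (measurable_backward_path s n). Qed.

Lemma expectation_path g s n : bounded_mfun g ->
  \int[gamma]_w g (path_from s w n) = iter n transition g s.
Proof.
move=> bg; elim: n s => [|n IH] s; first by rewrite /= expectation_cst.
rewrite (expectation_scons hgamma (bounded_mfun_path s n.+1 bg)).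
apply: eq_Rintegral => e _; rewrite -[RHS]IH.
by apply: eq_Rintegral => w _; rewrite path_fromSr.
Qed.

(** Integrating out the first shock, which drives the outermost map, replaces [g] by [transition g];
    hence the induction varies [g], whereas for forward paths it varies the starting point. *)
Lemma expectation_backward_path g s n : bounded_mfun g ->
  \int[gamma]_w g (backward_path s w n) = iter n transition g s.
Proof.
elim: n g => [|n IH] g bg; first by rewrite /= expectation_cst.
rewrite (expectation_scons_swap hgamma (bounded_mfun_backward s n.+1 bg)).
by rewrite iterSr -IH//; exact: bounded_mfun_transition.
Qed.

Variables (a b : 'rV[R]_k) (u : bool) (top : 'rV[R]_k).
Hypothesis psi_box : forall s e, box a b (psi s e).
Hypothesis box_top : box a b top.
Hypothesis top_max : forall s, box a b s -> lev_dir u s top.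
Hypothesis psi_mono : forall s s' e,
  lev_dir u s s' -> lev_dir u (psi s e) (psi s' e).
Hypothesis feller : forall g, continuous g -> continuous (transition g).

Lemma backward_path_box w n : box a b (backward_path top w n).
Proof. by case: n => [|n] /=. Qed.

(** The additional innermost map moves [top] to a point that cannot exceed it, and the outer
    monotone maps preserve this comparison. *)
Lemma backward_path_mono w n :
  lev_dir u (backward_path top w n.+1) (backward_path top w n).
Proof.
elim: n w => [|n IH] w; first exact/top_max/psi_box.
by apply: psi_mono; exact: IH.
Qed.

(** [nu] is the law of the limit [Y] of the backward iterates. Monotonicity makes this limit exist
    for every sequence of shocks, and bounded convergence passes expectations to it. *)
Lemma invariant_law_limit : exists nu : probability 'rV[R]_k R,
  [/\ nu (box a b) = 1%E,
      forall A, measurable A -> nu A = (\int[nu]_s Q [set e | A (psi s e)])%E &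
      forall g, continuous g -> bounded_mfun g ->
        (fun n => iter n transition g top) @ \oo --> \int[nu]_s g s].
Proof.
have /choice[Y Ylim] : forall w, exists y, box a b y /\ backward_path top w @ \oo --> y.
  move=> w.
  have [y by_ cy] := monotone_rV_cvg (backward_path_box w) (backward_path_mono w).
  by exists y.
have mY : measurable_fun setT Y.
  apply: (measurable_rV_limit (F := fun n w => backward_path top w n)).
    exact: measurable_backward_path.
  by move=> w; have [] := Ylim w.
have [nu nuE] := law_exists gamma mY.
have limE g : continuous g -> bounded_mfun g ->
    (fun n => iter n transition g top) @ \oo --> \int[nu]_s g s.
  move=> cg bg; rewrite (law_expectation mY nuE bg).
  have [mg [M gM]] := bg.
  have gY w : (fun n => g (backward_path top w n)) @ \oo --> (g \o Y) w.
    by apply: continuous_cvg; [exact: cg|have [] := Ylim w].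
  have [_] := @bounded_convergence _ _ _ gamma
    (fun n w => g (backward_path top w n)) (g \o Y) M
    (fun n => (bounded_mfun_backward top n bg).1) (fun n w => gM _) gY.
  rewrite (_ : (fun n => \int[_]_w _) = (fun n => iter n transition g top))//.
  by apply/funext => n; rewrite expectation_backward_path.
exists nu; split=> //.
  rewrite nuE; last exact: measurable_box.
  rewrite (_ : _ @^-1` _ = setT) ?probability_setT//.
  by apply/seteqP; split=> // w _; have [] := Ylim w.
(* The law of [psi s e] with [s] of law [nu] integrates every continuous [g]
   like [nu] does, because [T^(n+1) g top] has the same limit as [T^n g top]. *)
have [nu' nu'E] := law_exists (nu \x Q)%E mpsi.
move=> A mA; transitivity (nu' A); last first.
  rewrite nu'E//; apply: eq_integral => s _ /=; congr (Q _).
  by apply/seteqP; split=> e /=; rewrite /xsection/= inE.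
apply: continuous_law_unique A mA => g cg g1.
have bg : bounded_mfun g by split; [exact: continuous_rV_measurable_real|exists 1].
rewrite (law_expectation mpsi nu'E bg) expectation_prod1; last exact: bounded_mfun_psi.
have lim1 : (fun n => iter n.+1 transition g top) @ \oo --> \int[nu]_s g s.
  by rewrite (cvg_shiftS (fun n => iter n transition g top)); exact: limE.
have lim2 : (fun n => iter n.+1 transition g top) @ \oo -->
    \int[nu]_s transition g s.
  under eq_fun do rewrite iterSr.
  by apply: limE; [exact: feller|exact: bounded_mfun_transition].
exact: (cvg_unique (@norm_hausdorff _ _) lim1 lim2).
Qed.

End random_iteration.

(** * Almost sure bounds for averages over blocks *)

Section block_averages.
Context {R : realType} {d : measure_display} {E : measurableType d}.
Variables (Q : probability E R) (gamma : probability (shock_seq E) R).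
Hypothesis hgamma : is_product_law Q gamma.
Implicit Types (w : shock_seq E) (V Z : shock_seq E -> R).

(** Multiply [1 - x <= expR (- x)] by [expR x] and use that the product of [1 - x] and
    [1 + x + 2 * x ^+ 2] is [1 + x ^+ 2 * (1 - 2 * x)], which is at least 1 here. *)
Lemma expR_le_quadratic (x : R) : `|x| <= 2^-1 -> expR x <= 1 + x + 2 * x ^+ 2.
Proof.
rewrite ler_norml => /andP[x1 x2].
have h := expR_ge1Dx (- x); have h0 := expR_gt0 x.
have : expR (- x) * expR x = 1 by rewrite -expRD addNr expR0.
nra.
Qed.

Definition block_sum m V n w := \sum_(j < n) V (iter (j * m) shock_tail w).

Lemma block_sumS m V n w :
  block_sum m V n.+1 w = V w + block_sum m V n (iter m shock_tail w).
Proof.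
rewrite /block_sum big_ord_recl; congr (_ + _); apply: eq_bigr => i _.
by rewrite -iterD /= /bump/= add1n mulSn addnC.
Qed.

Lemma bounded_mfun_block_sum m V n :
  bounded_mfun V -> bounded_mfun (block_sum m V n).
Proof.
move=> bV; apply: bounded_mfun_sum => j.
exact: bounded_mfun_comp bV (measurable_iter_shock_tail _).
Qed.

Lemma expectation_exp_block_sum m V t n : bounded_mfun V -> depends_on_first m V ->
  \int[gamma]_w expR (t * block_sum m V n w) = (\int[gamma]_w expR (t * V w)) ^+ n.
Proof.
move=> bV dV; have bexp W : bounded_mfun W -> bounded_mfun (fun w => expR (t * W w)).
  by move=> bW; apply: bounded_mfun_expR; exact: bounded_mfunZ.
elim: n => [|n IH].
  rewrite expr0 -[RHS](expectation_cst gamma); apply: eq_Rintegral => w _.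
  by rewrite /block_sum big_ord0 mulr0 expR0.
rewrite exprS -IH -(expectation_indep hgamma (m := m)).
- by apply: eq_Rintegral => w _; rewrite block_sumS mulrDr expRD.
- exact: bexp.
- by apply: bexp; exact: bounded_mfun_block_sum.
- by move=> w w' ww'; rewrite (dV w w').
Qed.

(** Chernoff bound: for a small [t] the mean of [expR (t * V w)] is at most some [r < 1].
    Independence of the blocks bounds the probability of a nonnegative sum of [n] blocks by
    [r ^+ n], which is summable, and Borel-Cantelli applies. *)
Lemma ae_block_sum_lt0 m V : bounded_mfun V -> depends_on_first m V ->
  \int[gamma]_w V w < 0 ->
  {ae gamma, forall w, exists N, forall n, (N <= n)%N -> block_sum m V n w < 0}.
Proof.
move=> bV dV V0; set del := - \int[gamma]_w V w.
have del0 : 0 < del by rewrite oppr_gt0.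
have [mV [B VB]] := bV.
have delB : del <= B.
  by apply: le_trans (ler_norm _) _; rewrite normrN; exact: expectation_norm_le.
have B0 : 0 < B by exact: lt_le_trans delB.
(* [q] is the drift relative to the bound [B]. With [t * B = q / 4] the quadratic estimate of the
   exponential applies, and the mean of [expR (t * V w)] is at most
   [1 - q ^+ 2 / 4 + 2 * (q / 4) ^+ 2], which is [r]. *)
pose q := del / B.
have q0 : 0 < q by rewrite divr_gt0.
have q1 : q <= 1 by rewrite ler_pdivrMr// mul1r.
have delE : del = q * B by rewrite /q divfK// gt_eqF.
pose t := q / (4 * B).
have tB : t * B = q / 4 by rewrite /t; field; rewrite gt_eqF.
have t0 : 0 < t by rewrite divr_gt0// mulr_gt0.
pose r := 1 - q ^+ 2 / 8.
have r0 : 0 < r by rewrite /r; nra.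
have r1 : r < 1 by rewrite /r; nra.
have bexp W : bounded_mfun W -> bounded_mfun (fun w => expR (t * W w)).
  by move=> bW; apply: bounded_mfun_expR; exact: bounded_mfunZ.
have expV : \int[gamma]_w expR (t * V w) <= r.
  apply: (@le_trans _ _ (\int[gamma]_w (t * V w + (1 + q ^+ 2 / 8)))).
    apply: le_expectation.
    - exact: bexp.
    - by apply: bounded_mfunD; [exact: bounded_mfunZ|exact: bounded_mfun_cst].
    move=> w; have tVB : `|t * V w| <= q / 4.
      by rewrite normrM (ger0_norm (ltW t0)) -tB ler_pM2l.
    apply: le_trans (expR_le_quadratic _) _.
      by apply: le_trans tVB _; lra.
    rewrite -real_normK ?num_real//; move: (normr_ge0 (t * V w)); nra.
  rewrite expectationD; [|exact: bounded_mfunZ|exact: bounded_mfun_cst].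
  rewrite expectation_cst expectationZ//.
  have -> : \int[gamma]_w V w = - del by rewrite opprK.
  by rewrite delE mulrN mulrCA tB /r; nra.
pose A n := [set w | 0 <= block_sum m V n w].
have mA n : measurable (A n).
  have [mS _] := bounded_mfun_block_sum m n bV.
  rewrite (_ : A n = block_sum m V n @^-1` `[0, +oo[%classic).
    by rewrite -[X in measurable X]setTI; exact: mS.
  by apply/seteqP; split=> w; rewrite /A/= in_itv/= andbT.
have gA n : (gamma (A n) <= (r ^+ n)%:E)%E.
  rewrite -[leLHS]fineK ?fin_num_measure// lee_fin.
  have -> : fine (gamma (A n)) = \int[gamma]_w (\1_(A n) w).
    by rewrite /Rintegral integral_indic ?setIT.
  (* Exponential Markov inequality: the indicator of a nonnegative sum is at most the exponential of
     [t] times that sum. *)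
  apply: (@le_trans _ _ (\int[gamma]_w expR (t * block_sum m V n w))).
    apply: le_expectation.
    - split; first exact: measurable_indic.
      by exists 1 => w; rewrite indicE ger0_norm ?ler0n// lern1 leq_b1.
    - by apply: bexp; exact: bounded_mfun_block_sum.
    move=> w; rewrite indicE; have [|_] := boolP (w \in A n).
      by rewrite inE /A/= => Sw; rewrite -expR0 ler_expR mulr_ge0// ltW.
    exact: expR_ge0.
  rewrite expectation_exp_block_sum//; apply: lerXn2r expV.
    by rewrite nnegrE; apply: Rintegral_ge0 => w _; exact: expR_ge0.
  by rewrite nnegrE ltW.
have : gamma (lim_sup_set A) = 0%E.
  apply: lim_sup_set_cvg0 => //.
  apply: (@le_lt_trans _ _ ((1 - r)^-1)%:E); last exact: ltry.
  apply: lime_le; first exact: is_cvg_nneseries.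
  apply: nearW => n; apply: (@le_trans _ _ (\sum_(0 <= i < n) (r ^+ i)%:E)).
    by apply: lee_sum => i _; exact: gA.
  rewrite sumEFin lee_fin.
  have nr1 : `|r| < 1 by rewrite (ger0_norm (ltW r0)).
  have := @geometric_le_lim R n 1 r ler01 r0 nr1; rewrite mul1r.
  apply: le_trans.
  by rewrite /series/=; apply: ler_sum => i _; rewrite mul1r.
move=> gA0; exists (lim_sup_set A); split=> //.
  by apply: bigcapT_measurable => n; exact: bigcup_measurable.
move=> w /= Hw n _; apply: contrapT => nA; apply: Hw; exists n => j nj.
by rewrite ltNge; apply/negP => Aj; apply: nA; exists j.
Qed.

Lemma ae_block_sum_le m Z c : bounded_mfun Z -> depends_on_first m Z ->
  \int[gamma]_w Z w < c ->
  {ae gamma, forall w, exists N, forall n, (N <= n)%N ->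
    block_sum m Z n w <= n%:R * c}.
Proof.
move=> bZ dZ Zc.
have := @ae_block_sum_lt0 m (fun w => Z w - c) (bounded_mfunB bZ (bounded_mfun_cst c)).
rewrite expectationB ?expectation_cst ?subr_lt0//; last exact: bounded_mfun_cst.
have dV : depends_on_first m (fun w => Z w - c) by move=> w w' /dZ ->.
move=> /(_ dV Zc); apply: filterS => w [N HN]; exists N => n /HN/ltW.
rewrite /block_sum sumrB sumr_const card_ord subr_le0.
by rewrite [in X in _ -> X]mulr_natl.
Qed.

End block_averages.

(** * Perturbed transitions *)

Section perturbation.
Context {R : realType} {d : measure_display} {E : measurableType d} {k : nat}.
Variables (Q : probability E R) (a b : 'rV[R]_k).
Hypothesis hab : forall i, a 0 i <= b 0 i.
Variable psi : 'rV[R]_k -> E -> 'rV[R]_k.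
Hypothesis mpsi : measurable_fun setT (fun z : 'rV[R]_k * E => psi z.1 z.2).
Hypothesis psi_box : forall s e, box a b (psi s e).
Hypothesis psi_clamp : forall s e, psi (clamp a b s) e = psi s e.
Hypothesis feller : forall g, continuous g -> continuous (transition Q psi g).
Implicit Types (s : 'rV[R]_k) (g h : 'rV[R]_k -> R).

(** A signed [kappa] covers both perturbations: positive values give [phi_up], negative ones
    [phi_down]. The inner projection is absorbed into [psi], which is assumed to factor through
    [clamp]. *)
Definition perturbed (kappa : R) s e : 'rV[R]_k :=
  clamp a b (psi (s + const_mx kappa) e + const_mx kappa).

Lemma perturbed_box kappa s e : box a b (perturbed kappa s e).
Proof. exact: box_clamp. Qed.

Lemma continuous_translate (v : 'rV[R]_k) : continuous (fun s => s + v).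
Proof.
move=> s; apply: (@continuousD _ _ _ id (fun=> v)); last exact: cst_continuous.
by move=> A.
Qed.

Lemma measurable_perturbed kappa :
  measurable_fun setT (fun z : 'rV[R]_k * E => perturbed kappa z.1 z.2).
Proof.
have mtr : measurable_fun setT (fun s : 'rV[R]_k => s + const_mx kappa).
  by apply: continuous_rV_measurable; exact: continuous_translate.
apply: (measurableT_comp (continuous_rV_measurable (clamp_continuous hab))).
apply: (measurableT_comp mtr); apply: measurable_psi2 => //.
exact: (measurableT_comp mtr measurable_fst).
Qed.

Lemma perturbed_mono u kappa : (forall s s' e,
    lev_dir u s s' -> lev_dir u (psi s e) (psi s' e)) ->
  forall s s' e, lev_dir u s s' ->
    lev_dir u (perturbed kappa s e) (perturbed kappa s' e).
Proof.
move=> psi_mono.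
have shift_mono x y : lev_dir u x y ->
    lev_dir u (x + const_mx kappa) (y + const_mx kappa).
  by case: u {psi_mono} => xy i; rewrite !mxE lerD2r; exact: xy.
have clamp_mono x y : lev_dir u x y -> lev_dir u (clamp a b x) (clamp a b y).
  by case: u {psi_mono shift_mono} => xy; exact: lev_clamp.
by move=> s s' e /shift_mono/psi_mono-/(_ e)/shift_mono/clamp_mono.
Qed.

(** Compactness of the box, applied to pairs of a point and a translation near 0. The translated
    point may leave the box, so [g] is taken continuous on the whole space. *)
Lemma uniform_continuity_box g eps : continuous g -> 0 < eps ->
  exists2 kappa0 : R, 0 < kappa0 & forall kappa, `|kappa| <= kappa0 ->
    forall s, box a b s -> `|g (s + const_mx kappa) - g s| <= eps.
Proof.
move=> cg eps0.
have norm_cst (r : R) : `|const_mx r : 'rV[R]_k| <= `|r|.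
  by apply: norm_le_coord => // i; rewrite mxE.
have /compact_near_coveringP cover := @compact_box R k a b.
have : \forall r \near nbhs (0 : R),
    box a b `<=` (fun s => `|g (s + const_mx r) - g s| <= eps).
  apply: cover => s _.
  have : nbhs s [set t | `|g s - g t| <= eps / 2].
    by move/(@cvgrPdist_le _ _ _ (nbhs s)): (cg s); apply; rewrite divr_gt0.
  move=> /nbhs_ballP[e /= e0 He].
  exists (ball s (e / 2), ball (0 : R) (e / 2)).
    by split; apply: nbhsx_ballx; rewrite divr_gt0.
  move=> [t r] [/= st r0].
  have gt : `|g s - g t| <= eps / 2.
    by apply: He; apply: le_ball st; lra.
  have gtr : `|g s - g (t + const_mx r)| <= eps / 2.
    apply: He; rewrite -ball_normE /ball_/= opprD addrA.
    apply: le_lt_trans (ler_normB _ _) _.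
    move: st r0; rewrite -!ball_normE /ball_/= sub0r normrN => st r0.
    have := norm_cst r; lra.
  rewrite -(subrK (g s) (g (t + _))) -addrA.
  by apply: le_trans (ler_normD _ _) _; rewrite distrC; lra.
move=> /nbhs_ballP[e /= e0 He]; exists (e / 2); first by rewrite divr_gt0.
move=> r re s bs; apply: He bs => /=; rewrite /ball/= sub0r normrN.
by apply: le_lt_trans re _; lra.
Qed.

Definition clamp_invariant g := forall s, g (clamp a b s) = g s.

Lemma iter_transition_continuous n g :
  continuous g -> continuous (iter n (transition Q psi) g).
Proof. by move=> cg; elim: n => [//|n IH]; exact: feller. Qed.

Lemma iter_transition_clamp n g : clamp_invariant g ->
  clamp_invariant (iter n (transition Q psi) g).
Proof.
move=> gc; case: n => [//|n] s /=; apply: eq_Rintegral => e _.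
by rewrite psi_clamp.
Qed.

(** Each induction step costs three errors of [eps / 3]: replacing the perturbed iterate by the
    unperturbed one [v], dropping the outer translation by uniform continuity of [v], and dropping
    the inner translation by uniform continuity of its transition. *)
Lemma iter_transition_perturbed n g eps :
  continuous g -> clamp_invariant g -> bounded_mfun g -> 0 < eps ->
  exists2 kappa0 : R, 0 < kappa0 & forall kappa, `|kappa| <= kappa0 ->
    forall i, (i <= n)%N -> forall s, box a b s ->
    `|iter i (transition Q (perturbed kappa)) g s - iter i (transition Q psi) g s|
      <= eps.
Proof.
move=> cg gc bg; elim: n eps => [|n IH] eps eps0.
  exists 1 => // kappa _ i; rewrite leqn0 => /eqP -> s _ /=.
  by rewrite subrr normr0 ltW.
have eps3 : 0 < eps / 3 by rewrite divr_gt0.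
have [k1 k10 H1] := IH _ eps3.
pose v := iter n (transition Q psi) g.
have cv : continuous v by exact: iter_transition_continuous.
have vc : clamp_invariant v by exact: iter_transition_clamp.
have [k2 k20 H2] := uniform_continuity_box cv eps3.
have [k3 k30 H3] := uniform_continuity_box (feller cv) eps3.
have bv : bounded_mfun v by exact: bounded_mfun_iter_transition.
exists (Num.min k1 (Num.min k2 k3)); first by rewrite !lt_min k10 k20 k30.
move=> kappa; rewrite !le_min => /and3P[kk1 kk2 kk3] i.
rewrite leq_eqVlt ltnS => /predU1P[->|ilen] s bs; last first.
  by apply: le_trans (H1 _ kk1 _ ilen _ bs) _; lra.
rewrite !iterS -/v; set vk := iter n _ g.
have bvk : bounded_mfun vk.
  by apply: bounded_mfun_iter_transition => //; exact: measurable_perturbed.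
have step1 : `|transition Q (perturbed kappa) vk s
             - transition Q (perturbed kappa) v s| <= eps / 3.
  apply: expectation_dist.
  - exact: (bounded_mfun_psi_section (measurable_perturbed kappa)).
  - exact: (bounded_mfun_psi_section (measurable_perturbed kappa)).
  - by move=> e; apply: H1 => //; exact: perturbed_box.
have step2 : `|transition Q (perturbed kappa) v s
             - transition Q psi v (s + const_mx kappa)| <= eps / 3.
  apply: expectation_dist.
  - exact: (bounded_mfun_psi_section (measurable_perturbed kappa)).
  - exact: (bounded_mfun_psi_section mpsi).
  (* Clamp invariance of [v] removes the outer projection and leaves a pure translation. *)
  - by move=> e; rewrite /perturbed vc; exact: H2.
have := H3 _ kk3 _ bs => step3.
move: step1 step2 step3; rewrite !ler_norml; lra.
Qed.

End perturbation.

(** * Almost sure upper bounds for sums along dominated paths *)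

Section upper_average.
Context {R : realType} {d : measure_display} {E : measurableType d} {k : nat}.
Variables (Q : probability E R) (gamma : probability (shock_seq E) R).
Hypothesis hgamma : is_product_law Q gamma.
Variables a b : 'rV[R]_k.
Hypothesis hab : forall i, a 0 i <= b 0 i.
Variable psi : 'rV[R]_k -> E -> 'rV[R]_k.
Hypothesis mpsi : measurable_fun setT (fun z : 'rV[R]_k * E => psi z.1 z.2).
Hypothesis psi_box : forall s e, box a b (psi s e).
Hypothesis psi_clamp : forall s e, psi (clamp a b s) e = psi s e.
Hypothesis feller : forall g, continuous g -> continuous (transition Q psi g).
Variables (u : bool) (top : 'rV[R]_k).
Hypothesis box_top : box a b top.
Hypothesis top_max : forall s, box a b s -> lev_dir u s top.
Hypothesis psi_mono : forall s s' e,
  lev_dir u s s' -> lev_dir u (psi s e) (psi s' e).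

Lemma iter_shock_tailE q w n : iter q shock_tail w n = w (q + n)%N :> E.
Proof. by elim: q n => [//|q IH] n; rewrite iterS /shock_tail IH addSnnS. Qed.

(** Whatever happened before time [q], resetting to [top] restores domination, and monotonicity of
    [chi] propagates it. The sequence [x] need only satisfy a one-step inequality, which admits
    paths driven by nearby parameters. *)
Lemma path_dominated (chi : 'rV[R]_k -> E -> 'rV[R]_k) (x : nat -> 'rV[R]_k) w q n :
  (forall s s' e, lev_dir u s s' -> lev_dir u (chi s e) (chi s' e)) ->
  (forall i, box a b (x i)) ->
  (forall i, lev_dir u (x i.+1) (chi (x i) (w i))) ->
  lev_dir u (x (q + n)%N) (path_from chi top (iter q shock_tail w) n).
Proof.
move=> chi_mono bx xS; elim: n => [|n IH]; first by rewrite addn0; exact: top_max.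
rewrite addnS /= iter_shock_tailE; apply: lev_dir_trans (xS _) _.
exact: chi_mono.
Qed.

Variable h : 'rV[R]_k -> R.
Hypothesis h_continuous : continuous h.
Hypothesis h_bounded : bounded_mfun h.
Hypothesis h_clamp : clamp_invariant a b h.
Hypothesis h_mono : forall s s', lev_dir u s s' -> h s <= h s'.
Hypothesis h_le0 : forall s, h s <= 0.

Definition block_bound (chi : 'rV[R]_k -> E -> 'rV[R]_k) m w :=
  \sum_(i < m) h (path_from chi top w i.+1).

Lemma sum_le_block_sum (chi : 'rV[R]_k -> E -> 'rV[R]_k) (x : nat -> 'rV[R]_k) w m n :
  (forall s s' e, lev_dir u s s' -> lev_dir u (chi s e) (chi s' e)) ->
  (forall i, box a b (x i)) ->
  (forall i, lev_dir u (x i.+1) (chi (x i) (w i))) ->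
  \sum_(i < n * m) h (x i.+1) <= block_sum m (block_bound chi m) n w.
Proof.
move=> chi_mono bx xS; elim: n => [|n IH].
  by rewrite /block_sum mul0n !big_ord0.
rewrite mulSnr big_split_ord /block_sum big_ord_recr /= lerD//.
apply: ler_sum => i _; apply: h_mono; rewrite -addnS.
exact: path_dominated.
Qed.

(** The block length [m] is fixed first, from the Cesaro means of the iterates at [top]; then
    [kappa0] is chosen for this [m]. The almost sure event and [N0] come from the block variables
    alone, so they serve all sequences [x] at once. *)
Lemma ae_upper_average L eps :
  (fun n => iter n (transition Q psi) h top) @ \oo --> L -> 0 < eps ->
  exists2 kappa0 : R, 0 < kappa0 & forall kappa, `|kappa| <= kappa0 ->
  {ae gamma, forall w, exists N0, forall N, (N0 <= N)%N ->
    forall x : nat -> 'rV[R]_k, (forall i, box a b (x i)) ->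
    (forall i, lev_dir u (x i.+1) (perturbed a b psi kappa (x i) (w i))) ->
    \sum_(i < N) h (x i.+1) <= N%:R * (L + eps)}.
Proof.
move=> hL eps0; have eps4 : 0 < eps / 4 by rewrite divr_gt0.
pose T1 n := iter n.+1 (transition Q psi) h top.
have T1L : T1 @ \oo --> L.
  by rewrite (cvg_shiftS (fun n => iter n (transition Q psi) h top)).
have [m0 Hm0] : exists m0, `|L - arithmetic_mean T1 m0| <= eps / 4.
  have /cvgrPdist_le/(_ _ eps4)[m0 _ Hm0] := cesaro T1L.
  by exists m0; exact: (Hm0 m0 (leqnn m0)).
(* [arithmetic_mean T1 m0] averages the [m0.+1] terms of index 0 to [m0]. *)
pose m := m0.+1.
have meanT : \sum_(i < m) T1 i <= m%:R * (L + eps / 4).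
  have meanE : m%:R^-1 * \sum_(i < m) T1 i = arithmetic_mean T1 m0.
    by rewrite /arithmetic_mean /= seriesEord.
  have : m%:R^-1 * \sum_(i < m) T1 i <= L + eps / 4.
    by rewrite meanE; move: Hm0; rewrite ler_norml; lra.
  by rewrite ler_pdivrMl ?ltr0Sn.
have [kappa0 kappa00 Hk] := iter_transition_perturbed hab mpsi psi_box psi_clamp feller
  m h_continuous h_clamp h_bounded eps4.
exists kappa0 => // kappa kk.
set chi := perturbed a b psi kappa.
have mchi := measurable_perturbed hab mpsi kappa.
have chi_mono := perturbed_mono a b kappa psi_mono.
(* One quarter of [eps] pays for the Cesaro error, one for the perturbation, and one makes the
   inequality on the block mean strict; the last is kept for the incomplete block. *)
pose c := m%:R * (L + 3 / 4 * eps).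
have bZ : bounded_mfun (block_bound chi m).
  by apply: bounded_mfun_sum => i; exact: bounded_mfun_path.
have dZ : depends_on_first m (block_bound chi m).
  move=> w w' ww'; apply: eq_bigr => i _; congr h; apply: path_from_prefix => j ji.
  by apply: ww'; exact: leq_trans ji (ltn_ord i).
have EZ : \int[gamma]_w block_bound chi m w < c.
  rewrite expectation_sum; last by move=> i; exact: bounded_mfun_path.
  apply: (@le_lt_trans _ _ (\sum_(i < m) (T1 i + eps / 4))).
    apply: ler_sum => i _; rewrite (expectation_path hgamma mchi)//.
    have := Hk _ kk i.+1 (ltn_ord i) _ box_top; rewrite ler_norml /T1; lra.
  rewrite big_split /= sumr_const card_ord -mulr_natl.
  have m_gt0 : 0 < m%:R :> R by rewrite ltr0n.
  rewrite /c; nra.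
have := ae_block_sum_le hgamma bZ dZ EZ.
apply: filterS => w [n0 Hn0].
(* Beyond [N1], the discrepancy between [n * m] and [N], at most [m] steps, costs no more than
   [N%:R * (eps / 4)]. *)
pose N1 := Num.bound (m%:R * `|L + 3 / 4 * eps| / (eps / 4)).
exists (maxn (n0 * m) N1) => N; rewrite geq_max => /andP[n0N N1N] x bx xS.
pose n := (N %/ m)%N.
have NE : (n * m <= N)%N by exact: leq_divM.
have n0n : (n0 <= n)%N by rewrite leq_divRL.
have rE : N = (n * m + N %% m)%N by exact: divn_eq.
apply: (@le_trans _ _ (n%:R * c)).
  apply: le_trans (Hn0 _ n0n).
  apply: (@le_trans _ _ (\sum_(i < n * m) h (x i.+1))).
    (* The terms after the last complete block are nonpositive, so dropping them can only raise the
       sum. *)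
    rewrite [in leLHS]rE big_split_ord /= gerDl; apply: sumr_le0 => i _.
    exact: h_le0.
  exact: sum_le_block_sum.
have NR : N%:R = n%:R * m%:R + (N %% m)%:R :> R by rewrite {1}rE natrD natrM.
have r_ge0 : 0 <= (N %% m)%:R :> R by rewrite ler0n.
have r_le : (N %% m)%:R <= m%:R :> R by rewrite ler_nat ltnW// ltn_mod.
have N_large : m%:R * `|L + 3 / 4 * eps| <= N%:R * (eps / 4).
  rewrite -ler_pdivrMr//; apply: (@le_trans _ _ N1%:R); last by rewrite ler_nat.
  by apply/ltW/archi_boundP; rewrite divr_ge0 ?mulr_ge0// ltW.
have : - (m%:R * `|L + 3 / 4 * eps|) <= (N %% m)%:R * (L + 3 / 4 * eps).
  rewrite lerNl -mulrN; apply: (@le_trans _ _ ((N %% m)%:R * `|L + 3 / 4 * eps|)).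
    by rewrite ler_wpM2l// -normrN ler_norm.
  by rewrite ler_wpM2r.
rewrite /c mulrA -[n%:R * m%:R](addrK (N %% m)%:R) -NR.
nra.
Qed.

End upper_average.

(** * Uniformity in the parameter *)

(** Bridges the sequential form of the Feller assumption and topological continuity: a failure at
    [s] yields bad points in the balls of radius [n.+1%:R^-1]. *)
Lemma sequentially_continuous {R : realType} k (F : 'rV[R]_k -> R) :
  (forall (v : nat -> 'rV[R]_k) s, v @ \oo --> s -> (fun n => F (v n)) @ \oo --> F s) ->
  continuous F.
Proof.
move=> sF s; apply/(@cvgrPdist_le _ _ _ (nbhs s)) => eps eps0.
apply: contrapT => nF.
have /choice[v Hv] : forall n : nat, exists t, ball s n.+1%:R^-1 t /\
    ~ (`|F s - F t| <= eps).
  move=> n; apply: contrapT => nt; apply: nF.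
  apply/nbhs_ballP; exists n.+1%:R^-1; first by rewrite /= invr_gt0 ltr0n.
  by move=> t st; apply: contrapT => nt'; apply: nt; exists t.
have vs : v @ \oo --> s.
  apply/cvgrPdist_lt => e e0; near=> n.
  have [+ _] := Hv n; rewrite -ball_normE /ball_/= => /lt_trans; apply.
  by near: n; exact: near_infty_natSinv_lt (PosNum e0).
have /cvgrPdist_le/(_ _ eps0)[n _ /(_ n (leqnn n))] := sF v s vs.
by have [_] := Hv n.
Unshelve. all: by end_near. Qed.

Definition path_average {R : realType} {d : measure_display} {E : measurableType d}
    {k l p : nat} (phi : 'rV[R]_k -> E -> 'rV[R]_l -> 'rV[R]_k)
    (f : 'rV[R]_k -> 'rV[R]_p) N s0 w th : 'rV[R]_p :=
  N%:R^-1 *: (\sum_(1 <= n < N.+1) f (state_path phi s0 w th n)).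

Section fixed_parameter.
Context {R : realType} {k l p : nat} {d : measure_display} {E : measurableType d}.
Variables (Q : probability E R) (gamma : probability (shock_seq E) R).
Hypothesis hgamma : is_product_law Q gamma.
Variables a b : 'rV[R]_k.
Hypothesis hab : forall i, a 0 i <= b 0 i.
Variables (Theta : set 'rV[R]_l) (phi : 'rV[R]_k -> E -> 'rV[R]_l -> 'rV[R]_k).
Hypothesis hTheta : compact Theta.
Hypothesis hphi : forall s e th, box a b s -> Theta th -> box a b (phi s e th).
Hypothesis hA1 : jointly_measurable (box a b) Theta phi.
Hypothesis hA2 : monotone_in_state (box a b) Theta phi.
Hypothesis hA3 : weakly_continuous (box a b) Theta Q phi.
Hypothesis hA4 : sandwiched_near (box a b) Theta phi.
Variable f : 'rV[R]_k -> 'rV[R]_p.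
Hypothesis hf_cont : {within box a b, continuous f}.
Hypothesis hf_incr : increasing_on (box a b) f.

Lemma box_lower : box a b a.
Proof. by move=> i; rewrite lexx hab. Qed.

Lemma box_upper : box a b b.
Proof. by move=> i; rewrite lexx hab. Qed.

Lemma state_path_box s0 w th n : box a b s0 -> Theta th ->
  box a b (state_path phi s0 w th n).
Proof. by move=> bs tht; elim: n => [//|n IH] /=; exact: hphi. Qed.

(** [f] is continuous only relative to the box; the continuous map [clamp] has values there, so the
    composite is continuous on the whole space. *)
Lemma continuous_clamp_comp j : continuous (fun s => f (clamp a b s) 0 j).
Proof.
apply: sequentially_continuous => v s vs.
have cv : (fun n => clamp a b (v n)) @ \oo --> clamp a b s.
  by apply: continuous_cvg vs; exact: clamp_continuous.
have : (fun n => f (clamp a b (v n))) @ \oo --> f (clamp a b s).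
  move=> U fU.
  have : @nbhs_subspace _ (box a b) (clamp a b s) (f @^-1` U) := hf_cont fU.
  rewrite -nbhs_subspace_in; last exact: box_clamp.
  move=> /cv inU.
  have : \forall n \near \oo, box a b (clamp a b (v n)) -> U (f (clamp a b (v n))).
    exact: inU.
  by apply: filterS => n; apply; exact: box_clamp.
by move=> fcv; exact: (cvg_comp _ _ fcv (@coord_continuous R 1 p 0 j _)).
Qed.

Variables (mu : 'rV[R]_l -> probability 'rV[R]_k R).
Hypothesis hA5 : unique_invariant_laws (box a b) Theta Q phi mu.

(** * One-sided bounds around a fixed parameter *)

Section theta.
Variable th : 'rV[R]_l.
Hypothesis tht : Theta th.

(** The assumptions control [phi] on the box only. Precomposing with [clamp] gives a total map that
    is measurable, monotone and Feller on the whole space and agrees with [phi] on the box. *)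
Definition extension (s : 'rV[R]_k) (e : E) := phi (clamp a b s) e th.

Lemma extension_box s e : box a b (extension s e).
Proof. by apply: hphi => //; exact: box_clamp. Qed.

Lemma extension_clamp s e : extension (clamp a b s) e = extension s e.
Proof. by rewrite /extension (clamp_id (box_clamp hab _)). Qed.

Lemma extension_mono u s s' e :
  lev_dir u s s' -> lev_dir u (extension s e) (extension s' e).
Proof.
by case: u => /= ss'; (apply: hA2; [exact: tht| | |exact: lev_clamp]; exact: box_clamp).
Qed.

Lemma measurable_extension :
  measurable_fun setT (fun z : 'rV[R]_k * E => extension z.1 z.2).
Proof.
pose F (z : 'rV[R]_k * E) := (clamp a b z.1, z.2, th).
have mF : measurable_fun setT F.
  apply: measurable_fun_pair; last exact: measurable_cst.
  apply: measurable_fun_pair; last exact: measurable_snd.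
  apply: (measurableT_comp _ measurable_fst).
  exact: continuous_rV_measurable (clamp_continuous hab).
apply: (measurable_comp _ _ hA1 mF).
  apply: measurableX; last first.
    by apply: closed_rV_measurable; apply: compact_closed hTheta; exact: norm_hausdorff.
  by apply: measurableX => //; exact: measurable_box.
by move=> _ [z _ <-]; split=> //; split=> //; exact: box_clamp.
Qed.

Lemma extension_feller g : continuous g -> continuous (transition Q extension g).
Proof.
move=> cg; apply: sequentially_continuous => v s vs.
apply: (@hA3 th tht g _ (fun n => clamp a b (v n)) (clamp a b s)).
- exact: continuous_subspaceT.
- by move=> j; exact: box_clamp.
- exact: box_clamp.
- by apply: continuous_cvg vs; exact: clamp_continuous.
Qed.



Definition dir_sign (u : bool) : R := if u then 1 else -1.

Definition dir_top (u : bool) := if u then b else a.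

Lemma box_dir_top u : box a b (dir_top u).
Proof. by case: u; [exact: box_upper|exact: box_lower]. Qed.

Lemma dir_top_max u s : box a b s -> lev_dir u s (dir_top u).
Proof. by case: u => bs i; have /andP[] := bs i. Qed.

(** A coordinate of [f], with the sign that makes it increasing for [lev_dir u], shifted so that its
    maximum, reached at [dir_top u], is 0. This supplies the nonpositivity needed to discard
    incomplete blocks. *)
Definition centered u j s :=
  dir_sign u * (f (clamp a b s) 0 j - f (dir_top u) 0 j).

Lemma centered_clamp u j : clamp_invariant a b (centered u j).
Proof. by move=> s; rewrite /centered (clamp_id (box_clamp hab _)). Qed.

Lemma centered_mono u j s s' : lev_dir u s s' -> centered u j s <= centered u j s'.
Proof.
rewrite /centered; case: u => /= ss'; rewrite ?mul1r ?mulN1r ?lerN2 lerB//;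
  by apply: hf_incr; [exact: box_clamp|exact: box_clamp|exact: lev_clamp].
Qed.

Lemma centered_le0 u j s : centered u j s <= 0.
Proof.
rewrite -(centered_clamp u j).
apply: le_trans (centered_mono j (dir_top_max u (box_clamp hab s))) _.
by rewrite /centered clamp_id ?subrr ?mulr0//; exact: box_dir_top.
Qed.

Lemma bounded_mfun_clamp_comp j : bounded_mfun (fun s => f (clamp a b s) 0 j).
Proof.
split.
  by apply: continuous_rV_measurable_real; exact: continuous_clamp_comp.
exists (`|f a 0 j| + `|f b 0 j|) => s.
have fa : f a 0 j <= f (clamp a b s) 0 j.
  apply: hf_incr; [exact: box_clamp|exact: box_lower|].
  by move=> i; have /andP[] := box_clamp hab s i.
have fb : f (clamp a b s) 0 j <= f b 0 j.
  apply: hf_incr; [exact: box_upper|exact: box_clamp|].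
  by move=> i; have /andP[] := box_clamp hab s i.
have := ler_norm (f b 0 j); have := ler_norm (- f a 0 j).
have := normr_ge0 (f a 0 j); have := normr_ge0 (f b 0 j).
rewrite normrN ler_norml; lra.
Qed.

Lemma bounded_mfun_centered u j : bounded_mfun (centered u j).
Proof.
apply: bounded_mfunZ; apply: bounded_mfunB; last exact: bounded_mfun_cst.
exact: bounded_mfun_clamp_comp.
Qed.

Lemma centered_continuous u j : continuous (centered u j).
Proof.
move=> s; apply: (@continuousM _ _ (fun=> dir_sign u)
  (fun s => f (clamp a b s) 0 j - f (dir_top u) 0 j)); first exact: cst_continuous.
apply: (@continuousB _ _ _ (fun s => f (clamp a b s) 0 j) (fun=> f (dir_top u) 0 j)).
  exact: continuous_clamp_comp.
exact: cst_continuous.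
Qed.

(** The limit law [nu] is invariant for [extension] and carried by the box, where [extension] is
    [phi]; uniqueness therefore identifies it with [mu th] on subsets of the box, and integrals over
    the complement vanish. *)
Lemma iter_transition_centered u j :
  (fun n => iter n (transition Q extension) (centered u j) (dir_top u)) @ \oo -->
  dir_sign u * (expectation_on (box a b) (mu th) f 0 j - f (dir_top u) 0 j).
Proof.
have mbox := measurable_box a b.
have [nu [nu1 nuE nulim]] := @invariant_law_limit _ _ _ _ Q gamma hgamma extension
  measurable_extension a b u (dir_top u) extension_box (box_dir_top u)
  (@dir_top_max u) (@extension_mono u) extension_feller.
have nuC : nu (~` box a b) = 0%E.
  by rewrite probability_setC// nu1 subee.
have [_ /(_ nu) uniq] := hA5 tht.
have {}uniq : forall A, measurable A -> A `<=` box a b -> nu A = mu th A.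
  apply: uniq; split=> // A mA Abox; rewrite nuE//.
  rewrite (@ge0_negligible_integral _ _ _ _ setT (~` box a b))//; [|exact: measurableC|].
  - rewrite setTD setCK; apply: eq_integral => s; rewrite inE => bs.
    by rewrite /extension clamp_id.
  - have mA' : measurable ((fun z => extension z.1 z.2) @^-1` A).
      by rewrite -[X in measurable X]setTI; exact: measurable_extension.
    have := measurable_fun_xsection Q mA'; apply: eq_measurable_fun => s _ /=.
    by congr (Q _); apply/seteqP; split=> e /=; rewrite /xsection/= inE.
have -> : dir_sign u * (expectation_on (box a b) (mu th) f 0 j - f (dir_top u) 0 j)
    = \int[nu]_s centered u j s.
  rewrite /centered expectationZ; last first.
    by apply: bounded_mfunB; [exact: bounded_mfun_clamp_comp|exact: bounded_mfun_cst].
  rewrite expectationB ?expectation_cst; last exact: bounded_mfun_cst.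
    congr (_ * (_ - _)); rewrite mxE; congr fine.
    rewrite [RHS](negligible_integral (N := ~` box a b))//; [|exact: measurableC|].
    + rewrite setTD setCK (eq_measure_integral nu); last first.
        by move=> A mA Abox; apply/esym; exact: uniq.
      by apply: eq_integral => s; rewrite inE => bs; rewrite clamp_id.
    + by apply: bounded_mfun_integrable; exact: bounded_mfun_clamp_comp.
  exact: bounded_mfun_clamp_comp.
by apply: nulim; [exact: centered_continuous|exact: bounded_mfun_centered].
Qed.

Lemma path_average_coord N s0 w th' j :
  path_average phi f N s0 w th' 0 j =
  N%:R^-1 * \sum_(i < N) f (state_path phi s0 w th' i.+1) 0 j.
Proof. by rewrite /path_average big_add1 big_mkord mxE summxE. Qed.

(** Near [th], a step of the true dynamics at [th'] is dominated by the perturbed step at [th]. The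
    upper bound for the single perturbed chain thus holds for all these [th'] outside one null
    set. *)
Lemma ae_one_sided_average u j eps : 0 < eps ->
  exists2 V, open_nbhs th V & {ae gamma, forall w, \forall N \near \oo,
    forall s0 th', box a b s0 -> V th' -> Theta th' ->
    dir_sign u * (path_average phi f N s0 w th' 0 j -
                  expectation_on (box a b) (mu th) f 0 j) <= eps}.
Proof.
move=> eps0.
have [kappa0 kappa00 Hk] := ae_upper_average hgamma hab measurable_extension
  extension_box extension_clamp extension_feller (box_dir_top u)
  (@dir_top_max u) (@extension_mono u) (@centered_continuous u j)
  (bounded_mfun_centered u j) (centered_clamp u j) (@centered_mono u j)
  (centered_le0 u j) (@iter_transition_centered u j) eps0.
(* Upper bounds perturb upwards, lower bounds downwards. *)
pose kappa := dir_sign u * kappa0.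
have {}Hk := Hk kappa.
have [V [oV Vth VP]] := hA4 tht kappa00.
have dom s e th' : box a b s -> V th' -> Theta th' ->
    lev_dir u (phi s e th') (perturbed a b extension kappa s e).
  move=> bs Vth' tht'; have [_ /(_ s e bs)] := VP th' (conj Vth' tht').
  rewrite /phi_up /phi_down !nearest_point_box// /perturbed /extension /kappa /dir_sign.
  case: (u) => -[up down]; first by rewrite mul1r.
  rewrite mulN1r (_ : const_mx (- kappa0) = - const_mx kappa0)//.
  by apply/rowP => i; rewrite !mxE.
exists V => //; have : `|kappa| <= kappa0.
  rewrite /kappa normrM (ger0_norm (ltW kappa00)) /dir_sign.
  by case: (u); rewrite ?normrN normr1 mul1r.
move=> /Hk; apply: (@filterS _ (almost_everywhere gamma)) => w [N0 HN0].
(* The successor makes [N] positive, so that dividing by it is legitimate. *)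
exists N0.+1 => // N /= N0N s0 th' bs0 Vth' tht'.
have Npos : 0 < N%:R :> R by rewrite ltr0n; exact: leq_trans N0N.
have := HN0 N (ltnW N0N) (fun i => state_path phi s0 w th' i) _ _.
have bx i : box a b (state_path phi s0 w th' i) by exact: state_path_box.
move=> /(_ bx) -/(_ (fun i => dom _ _ _ (bx i) Vth' tht')).
pose S := \sum_(i < N) f (state_path phi s0 w th' i.+1) 0 j.
pose c := f (dir_top u) 0 j.
have -> : \sum_(i < N) centered u j (state_path phi s0 w th' i.+1)
    = dir_sign u * (S - N%:R * c).
  rewrite /centered -mulr_sumr sumrB sumr_const card_ord [in RHS]mulr_natl.
  by congr (_ * (_ - _)); apply: eq_bigr => i _; rewrite (clamp_id (bx _)).
rewrite path_average_coord -/S -/c => H; rewrite -(ler_pM2l Npos).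
have -> : N%:R * (dir_sign u * (N%:R^-1 * S - expectation_on (box a b) (mu th) f 0 j)) =
  dir_sign u * (S - N%:R * c) -
  N%:R * (dir_sign u * (expectation_on (box a b) (mu th) f 0 j - c)).
  by field; rewrite gt_eqF.
by rewrite lerBlDl -mulrDr.
Qed.

End theta.

(** * Uniformity over a neighbourhood, then over the compact parameter set *)

Lemma ae_average_near th eps : Theta th -> 0 < eps ->
  exists2 V, open_nbhs th V & {ae gamma, forall w, \forall N \near \oo,
    forall s0 th', box a b s0 -> V th' -> Theta th' -> forall j,
    `|path_average phi f N s0 w th' 0 j -
      expectation_on (box a b) (mu th) f 0 j| <= eps}.
Proof.
move=> tht eps0.
(* There are finitely many pairs of a coordinate and a direction, so neighbourhoods, null sets and
   thresholds can all be combined. *)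
have /choice[V HV] : forall x : 'I_p * bool, exists V, open_nbhs th V /\
    {ae gamma, forall w, \forall N \near \oo,
    forall s0 th', box a b s0 -> V th' -> Theta th' ->
    dir_sign x.2 * (path_average phi f N s0 w th' 0 x.1 -
                  expectation_on (box a b) (mu th) f 0 x.1) <= eps}.
  by move=> [j u]; have [V oV VP] := ae_one_sided_average tht u j eps0; exists V.
have nV : nbhs th [set th' | forall x, V x th'].
  have : \forall th' \near nbhs th, forall x, V x th'.
    apply: filter_forall => x; apply: open_nbhs_nbhs.
    by have [] := HV x.
  by [].
exists ([set th' | forall x, V x th']°).
  by split; [exact: open_interior|exact: nV].
have : {ae gamma, forall w, forall x : 'I_p * bool, \forall N \near \oo,
    forall s0 th', box a b s0 -> V x th' -> Theta th' ->
    dir_sign x.2 * (path_average phi f N s0 w th' 0 x.1 -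
                  expectation_on (box a b) (mu th) f 0 x.1) <= eps}.
  by apply: (@filter_forall _ _ _ (almost_everywhere gamma)) => x; have [] := HV x.
apply: (@filterS _ (almost_everywhere gamma)) => w /filter_forall.
apply: filterS => N HN s0 th' bs0 /interior_subset Vth' tht' j.
have := HN (j, true) s0 th' bs0 (Vth' _) tht'.
have := HN (j, false) s0 th' bs0 (Vth' _) tht'.
rewrite /dir_sign /= mul1r mulN1r ler_norml; lra.
Qed.

(** The averages at [th'] are close to the expectation at [th] and, by the same result centred at
    [th'], to the one at [th']. Comparing both at one common [w] and [N] brings the two
    deterministic expectations within [2 * (eps / 3)]. *)
Lemma ae_uniform_average_near th eps : Theta th -> 0 < eps ->
  exists2 V, open_nbhs th V & {ae gamma, forall w, \forall N \near \oo,
    forall s0 th', box a b s0 -> V th' -> Theta th' -> forall j,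
    `|path_average phi f N s0 w th' 0 j -
      expectation_on (box a b) (mu th') f 0 j| <= eps}.
Proof.
move=> tht eps0; have eps3 : 0 < eps / 3 by rewrite divr_gt0.
have [V oV VP] := ae_average_near tht eps3.
exists V => //; have close th' : V th' -> Theta th' -> forall j,
    `|expectation_on (box a b) (mu th) f 0 j -
      expectation_on (box a b) (mu th') f 0 j| <= 2 * (eps / 3).
  move=> Vth' tht' j; have [V' [_ Vth''] VP'] := ae_average_near tht' eps3.
  (* As [gamma] has mass 1, events of full measure intersect, which provides the common [w]. *)
  have gamma_proper : ProperFilter (almost_everywhere gamma).
    apply: ae_properfilter_algebraOfSetsType.
    by rewrite [X in (0 < X)%E](_ : _ = 1%E) ?lte01//; exact: probability_setT.
  have [w [Hw Hw']] := @filter_ex _ (almost_everywhere gamma) _ _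
    (@filterI _ (almost_everywhere gamma) _ _ _ VP VP').
  have [N [HN HN']] := filter_ex (filterI Hw Hw').
  have := HN a th' box_lower Vth' tht' j.
  have := HN' a th' box_lower Vth'' tht' j.
  rewrite !ler_norml; lra.
move: VP; apply: (@filterS _ (almost_everywhere gamma)) => w.
apply: filterS => N HN s0 th' bs0 Vth' tht' j.
have := HN s0 th' bs0 Vth' tht' j; have := close th' Vth' tht' j.
rewrite !ler_norml; lra.
Qed.

Lemma ae_uniform_average eps : 0 < eps ->
  {ae gamma, forall w, \forall N \near \oo,
    forall s0 th, box a b s0 -> Theta th -> forall j,
    `|path_average phi f N s0 w th 0 j -
      expectation_on (box a b) (mu th) f 0 j| <= eps}.
Proof.
move=> eps0.
have /choice[V HV] : forall t, exists V, Theta t -> open_nbhs t V /\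
    {ae gamma, forall w, \forall N \near \oo,
    forall s0 th', box a b s0 -> V th' -> Theta th' -> forall j,
    `|path_average phi f N s0 w th' 0 j -
      expectation_on (box a b) (mu th') f 0 j| <= eps}.
  (* Outside [Theta] the value [setT] is a mere default for the choice function. *)
  move=> t; have [tht|nt] := pselect (Theta t); last by exists setT.
  by have [V oV VP] := ae_uniform_average_near tht eps0; exists V.
move: hTheta; rewrite compact_cover => /(_ _ Theta V)[].
- by move=> t /HV[[]].
- by move=> t tht; exists t => //; have [[]] := HV t tht.
move=> D DTheta coverD.
have : {ae gamma, forall w, forall t : D, \forall N \near \oo,
    forall s0 th', box a b s0 -> V (val t) th' -> Theta th' -> forall j,
    `|path_average phi f N s0 w th' 0 j -
      expectation_on (box a b) (mu th') f 0 j| <= eps}.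
  apply: (@filter_forall _ _ _ (almost_everywhere gamma)) => t.
  by have [] := HV (val t) (set_mem (DTheta _ (valP t))).
apply: (@filterS _ (almost_everywhere gamma)) => w /filter_forall.
apply: filterS => N HN s0 th' bs0 tht' j.
have [t tD Vt] := coverD th' tht'.
exact: (HN [` tD]%fset).
Qed.

End fixed_parameter.

(** * Arbitrary norms and the conclusion *)

Lemma is_norm_le_coord {R : realType} p (nrm : 'rV[R]_p -> R) (x : 'rV[R]_p) e :
  is_norm nrm -> (forall j, `|x 0 j| <= e) ->
  nrm x <= e * \sum_(j < p) nrm (delta_mx 0 j).
Proof.
move=> [nrm_ge0 _ nrmZ nrmD] xe.
have nrm0 : nrm 0 = 0 by rewrite -(scale0r 0) nrmZ normr0 mul0r.
(* Expand [x] in the standard basis and use the triangle inequality and homogeneity. *)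
rewrite [x in leLHS]row_sum_delta mulr_sumr.
elim/big_ind2 : _ => [|y1 r1 y2 r2 h1 h2|j _]; first by rewrite nrm0.
  exact: le_trans (nrmD _ _) (lerD h1 h2).
by rewrite nrmZ ler_wpM2r.
Qed.

Theorem proposition4p3 (R : realType) (k l p : nat)
  (d : measure_display) (E : measurableType d) (Q : probability E R)
  (gamma : probability (shock_seq E) R) (hgamma : is_product_law Q gamma)
  (a b : 'rV[R]_k) (hab : forall i, a 0 i < b 0 i)
  (Theta : set 'rV[R]_l) (hTheta : compact Theta)
  (phi : 'rV[R]_k -> E -> 'rV[R]_l -> 'rV[R]_k)
  (hphi : forall s e th, box a b s -> Theta th -> box a b (phi s e th))
  (mu : 'rV[R]_l -> probability 'rV[R]_k R)
  (hA1 : jointly_measurable (box a b) Theta phi)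
  (hA2 : monotone_in_state (box a b) Theta phi)
  (hA3 : weakly_continuous (box a b) Theta Q phi)
  (hA4 : sandwiched_near (box a b) Theta phi)
  (hA5 : unique_invariant_laws (box a b) Theta Q phi mu)
  (nrm : 'rV[R]_p -> R) (hnrm : is_norm nrm)
  (f : 'rV[R]_k -> 'rV[R]_p)
  (hf_cont : {within box a b, continuous f})
  (hf_incr : increasing_on (box a b) f) :
  exists Omega_hat : set (shock_seq E),
    [/\ measurable Omega_hat, gamma Omega_hat = 1%E &
      forall w, Omega_hat w -> forall eps : R, 0 < eps ->
      exists N_eps : nat, forall s0, box a b s0 ->
      forall N : nat, (N_eps <= N)%N -> forall th, Theta th ->
        nrm (N%:R^-1 *: (\sum_(1 <= n < N.+1) f (state_path phi s0 w th n))
             - expectation_on (box a b) (mu th) f) < eps].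

Proof.
have hab_le i : a 0 i <= b 0 i by exact: ltW.
(* The countably many tolerances [q.+1%:R^-1] share one measurable null set [A], whose complement is
   the required event. *)
have [A [mA A0 HA]] : {ae gamma, forall w, forall q, \forall N \near \oo,
    forall s0 th, box a b s0 -> Theta th -> forall j,
    `|path_average phi f N s0 w th 0 j -
      expectation_on (box a b) (mu th) f 0 j| <= q.+1%:R^-1}.
  apply: ae_foralln => q.
  apply: (ae_uniform_average hgamma hab_le hTheta hphi hA1 hA2 hA3 hA4 hf_cont
    hf_incr hA5).
  by rewrite invr_gt0 ltr0n.
exists (~` A); split; first exact: measurableC.
  by rewrite probability_setC// A0 sube0.
move=> w nAw eps eps0.
have Hw := contrapT (fun nH => nAw (HA w nH)).
pose C := \sum_(j < p) nrm (delta_mx 0 j).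
have C_ge0 : 0 <= C by apply: sumr_ge0 => j _; case: hnrm.
(* With this [q], the coordinate tolerance [q.+1%:R^-1] times the norm constant [C] is below
   [eps]. *)
pose q := Num.bound (C / eps).
have [N0 _ HN0] := Hw q.
exists N0 => s0 bs0 N N0N th tht.
apply: (@le_lt_trans _ _ (q.+1%:R^-1 * C)).
  apply: is_norm_le_coord hnrm _ => j.
  have := HN0 N N0N s0 th bs0 tht j.
  by rewrite [X in _ -> `|X| <= _]mxE [X in _ -> `|_ + X| <= _]mxE.
rewrite mulrC ltr_pdivrMr ?ltr0n// mulrC -ltr_pdivrMr//.
apply: (@lt_trans _ _ q%:R); last by rewrite ltr_nat.
by apply: archi_boundP; rewrite divr_ge0// ltW.
Qed.
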